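(* Let $\ell$ be a rational prime. Let $X$ be a connected (finite) graph with $\chi(X)\neq 0$, and let $$X=X_0\leftarrow X_1\leftarrow\cdots\leftarrow X_n\leftarrow\cdots \qquad (\ast)$$ be an (unbranched) $\mathbb{Z}_\ell$-tower above $X$. Let $p:Y\to X$ be a Galois cover of graphs whose Galois group is a finite $\ell$-group, and pull back the tower $(\ast)$ along $p$ to obtain $$Y\leftarrow Y\times_X X_1\leftarrow Y\times_X X_2\leftarrow\cdots\leftarrow Y\times_X X_n\leftarrow\cdots. \qquad (\ast\ast)$$ Assume that all the graphs in both towers are connected, so that $(\ast\ast)$ is a $\mathbb{Z}_\ell$-tower above $Y$. Let $\mu_X,\lambda_X$ be the Iwasawa invariants of $(\ast)$ and let $\mu_Y,\lambda_Y$ be the Iwasawa invariants of $(\ast\ast)$. Then $\mu_X=0$ if and only if $\mu_Y=0$, in which case $$\lambda_Y+1=[Y:X]\,(\lambda_X+1),$$ where $[Y:X]$ is the degree of the cover $Y/X$.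
   Context: Graphs (in the sense of Serre). A graph $X$ consists of a finite set of vertices $V_X$, a finite set of directed edges $\mathbf{E}_X$, an incidence map $e\mapsto (o(e),t(e))\in V_X\times V_X$ and an inversion $e\mapsto\bar e$ on $\mathbf{E}_X$ with $\bar e\ne e$, $\bar{\bar e}=e$, $o(\bar e)=t(e)$, $t(\bar e)=o(e)$. Loops and parallel edges are allowed. The set $E_X$ of undirected edges is $\mathbf{E}_X$ modulo $e\sim\bar e$. For $v\in V_X$, $\mathbf{E}_{X,v}=\{e\in\mathbf{E}_X: o(e)=v\}$. The Euler characteristic of a connected graph is $\chi(X)=|V_X|-|E_X|$. All graphs are finite. Morphisms and covers. A morphism $f:Y\to X$ is a pair of maps $V_Y\to V_X$, $\mathbf{E}_Y\to\mathbf{E}_X$ (both denoted $f$) commuting with $o$, $t$ and inversion. It is a cover if it is surjective on vertices and, for every $w\in V_Y$, restricts to a bijection $\mathbf{E}_{Y,w}\to\mathbf{E}_{X,f(w)}$. If $Y$ is connected, all fibers $f^{-1}(v)$, $v\in V_X$, have the same cardinality, the degree $[Y:X]$. Let $\mathrm{Aut}_f(Y/X)=\{\sigma\in\mathrm{Aut}(Y): f\circ\sigma=f\}$. The cover $f$ is Galois if $Y$ is connected and $\mathrm{Aut}_f(Y/X)$ acts transitively on $f^{-1}(v)$ for every $v\in V_X$; then one writes $\mathrm{Gal}(Y/X)=\mathrm{Aut}_f(Y/X)$. $\mathbb{Z}_\ell$-towers. A $\mathbb{Z}_\ell$-tower above a connected graph $X$ is a sequence of covers of connected graphs $X=X_0\leftarrow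 X_1\leftarrow\cdots\leftarrow X_n\leftarrow\cdots$ such that for every $n\ge 1$ the composite cover $X_n\to X$ is Galois with Galois group isomorphic to $\mathbb{Z}/\ell^n\mathbb{Z}$. Pullbacks. For morphisms $p_1:Y_1\to X$, $p_2:Y_2\to X$, the pullback $Y_1\times_X Y_2$ has vertices $\{(w_1,w_2)\in V_{Y_1}\times V_{Y_2}: p_1(w_1)=p_2(w_2)\}$ and directed edges $\{(e_1,e_2)\in\mathbf{E}_{Y_1}\times\mathbf{E}_{Y_2}: p_1(e_1)=p_2(e_2)\}$, with $o$, $t$ and inversion defined componentwise. The maps $Y\times_X X_{n+1}\to Y\times_X X_n$ in the pulled back tower are the identity on the first component and the tower map $X_{n+1}\to X_n$ on the second. Iwasawa invariants. It is a known theorem that for a $\mathbb{Z}_\ell$-tower $X=X_0\leftarrow X_1\leftarrow\cdots$ above a connected graph $X$ with $\chi(X)\neq 0$, if $\kappa_n$ denotes the number of spanning trees of $X_n$, there exist (unique) integers $\mu\ge 0$, $\lambda\ge 0$, $\nu$ such that $\mathrm{ord}_\ell(\kappa_n)=\mu\ell^n+\lambda n+\nu$ for all sufficiently large $n$. The integers $\mu,\lambda$ are called the Iwasawa invariants of the tower. (Here $\chi(Y)=[Y:X]\chi(X)\neq 0$, so this applies to the tower above $Y$ as well.) *)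

(* Defs.v *)
From HB Require Import structures.
From mathcomp Require Import all_boot all_order all_algebra.
From mathcomp Require Import all_fingroup all_solvable.

Set Implicit Arguments.
Unset Strict Implicit.
Unset Printing Implicit Defensive.

Import GRing.Theory.

Record sgraph := SGraph {
  vertex : finType;
  dedge : finType;
  org : dedge -> vertex;
  trm : dedge -> vertex;
  einv : dedge -> dedge;
  einv_neq : forall e, einv e != e;
  einvK : involutive einv;
  org_inv : forall e, org (einv e) = trm e;
  trm_inv : forall e, trm (einv e) = org e
}.

Arguments org {s}.
Arguments trm {s}.
Arguments einv {s}.

Definition uedges (X : sgraph) : {set {set dedge X}} :=
  [set [set e; einv e] | e : dedge X].

Definition star (X : sgraph) (v : vertex X) : {set dedge X} :=
  [set e | org e == v].

Definition euler_char (X : sgraph) : int :=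
  (#|vertex X|%:Z - #|uedges X|%:Z)%R.

Definition adj (X : sgraph) (A : {set dedge X}) : rel (vertex X) :=
  fun v w => [exists e in A, (org e == v) && (trm e == w)].

(* Connectedness of the spanning subgraph with directed edges A; the empty
   graph is not connected. *)
Definition connected_by (X : sgraph) (A : {set dedge X}) : bool :=
  (0 < #|vertex X|) && [forall v, forall w, connect (adj A) v w].

Definition connected (X : sgraph) : bool := connected_by [set: dedge X].

(* Circuits as closed paths without backtracking through distinct vertices.
   The non-backtracking condition excludes [:: e; einv e]; a loop is a circuit
   of length 1, and two distinct parallel edges give one of length 2. *)
Definition circuit (X : sgraph) (c : seq (dedge X)) : bool :=
  [&& c != [::],
      path.cycle (fun e e' => (trm e == org e') && (e' != einv e)) c
    & uniq (map org c)].

(* A circuit has at most #|vertex X| edges, whence the bound (see [acyclicP]). *)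
Definition acyclic (X : sgraph) (A : {set dedge X}) : bool :=
  [forall c : #|vertex X|.-bseq (dedge X), all (mem A) c ==> ~~ circuit c].

Lemma acyclicP (X : sgraph) (A : {set dedge X}) :
  reflect (forall c : seq (dedge X), all (mem A) c -> ~~ circuit c) (acyclic A).
Proof.
apply: (iffP forallP) => [acA c Ac | acA c]; last exact/implyP/acA.
apply/negP => circ_c; have /and3P[_ _ uc] := circ_c.
have szc : size c <= #|vertex X|.
  by rewrite -(size_map org) -(card_uniqP uc) max_card.
by have /implyP/(_ Ac)/negP := acA (Bseq szc); apply.
Qed.

(* A spanning subgraph is given by its inversion-stable set of directed edges. *)
Definition spanning_tree (X : sgraph) (A : {set dedge X}) : bool :=
  [&& [forall e in A, einv e \in A], connected_by A & acyclic A].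

Definition spanning_trees (X : sgraph) : {set {set dedge X}} :=
  [set A | spanning_tree A].

Record ghom (Y X : sgraph) := GHom {
  hV : vertex Y -> vertex X;
  hE : dedge Y -> dedge X;
  hom_org : forall e, org (hE e) = hV (org e);
  hom_trm : forall e, trm (hE e) = hV (trm e);
  hom_inv : forall e, einv (hE e) = hE (einv e)
}.

Definition ghom_id (X : sgraph) : ghom X X :=
  @GHom X X id id (fun=> erefl) (fun=> erefl) (fun=> erefl).

Section Comp.
Variables (Z Y X : sgraph) (g : ghom Y X) (f : ghom Z Y).

Lemma comp_org e : org (hE g (hE f e)) = hV g (hV f (org e)).
Proof. by rewrite !hom_org. Qed.

Lemma comp_trm e : trm (hE g (hE f e)) = hV g (hV f (trm e)).
Proof. by rewrite !hom_trm. Qed.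

Lemma comp_inv e : einv (hE g (hE f e)) = hE g (hE f (einv e)).
Proof. by rewrite !hom_inv. Qed.

Definition ghom_comp : ghom Z X :=
  @GHom Z X (fun w => hV g (hV f w)) (fun e => hE g (hE f e))
    comp_org comp_trm comp_inv.
End Comp.

Definition is_cover (Y X : sgraph) (f : ghom Y X) : Prop :=
  (forall v, exists w, hV f w = v) /\
  (forall w, {in star w &, injective (hE f)} /\
             hE f @: star w = star (hV f w)).

Definition fiber (Y X : sgraph) (f : ghom Y X) (v : vertex X) :
  {set vertex Y} := [set w | hV f w == v].

(* The cardinality of some fiber; [card_fiber] shows that the choice of the
   fiber is irrelevant. *)
Definition degree (Y X : sgraph) (f : ghom Y X) : nat :=
  if [pick v : vertex X] is Some v then #|fiber f v| else 0.

Lemma card_fiber_edge (Y X : sgraph) (f : ghom Y X) (e : dedge X) :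
  is_cover f -> #|fiber f (org e)| = #|[set e' | hE f e' == e]|.
Proof.
case=> _ covf.
have -> : fiber f (org e) = org @: [set e' | hE f e' == e].
  apply/setP=> w; rewrite inE; apply/eqP/imsetP => [fw | [e']].
    have /setP/(_ e) := (covf w).2; rewrite !inE fw eqxx.
    by case/imsetP=> e'; rewrite inE => /eqP we' ->; exists e'; rewrite ?inE.
  by rewrite inE => /eqP <- ->; rewrite hom_org.
apply: card_in_imset => e1 e2; rewrite !inE => /eqP fe1 /eqP fe2 e12.
by apply: (covf (org e1)).1; rewrite ?inE ?e12 ?eqxx // fe1 fe2.
Qed.

Lemma card_fiber (Y X : sgraph) (f : ghom Y X) (v : vertex X) :
  is_cover f -> connected Y -> #|fiber f v| = degree f.
Proof.
move=> covf /andP[_ /forallP conY]; rewrite /degree.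
case: pickP => [u _ | /(_ v) //].
have [w <-] := covf.1 v; have [w' <-] := covf.1 u.
have /forallP/(_ w')/connectP[s ps ->] := conY w.
elim: s w ps => //= w1 s IHs w /andP[/exists_inP[e _ /andP[/eqP <- /eqP we]] ps].
rewrite -(IHs w1 ps) -we -org_inv -!hom_org !card_fiber_edge // -hom_inv.
rewrite -(card_imset _ (inv_inj (@einvK Y))); apply: eq_card => e'.
rewrite inE; apply/imsetP/eqP => [[e1] | fe'].
  by rewrite inE => /eqP <- ->; rewrite hom_inv.
by exists (einv e'); rewrite ?einvK // inE -hom_inv fe' einvK.
Qed.

Definition graph_aut (Y : sgraph) (s : {perm vertex Y} * {perm dedge Y}) :
  bool :=
  [forall e, [&& org (s.2 e) == s.1 (org e), trm (s.2 e) == s.1 (trm e)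
               & einv (s.2 e) == s.2 (einv e)]].

Definition cover_aut (Y X : sgraph) (f : ghom Y X) :
  {set {perm vertex Y} * {perm dedge Y}} :=
  [set s | [&& graph_aut s, [forall w, hV f (s.1 w) == hV f w]
             & [forall e, hE f (s.2 e) == hE f e]]].

Lemma cover_aut_group_set (Y X : sgraph) (f : ghom Y X) :
  group_set (cover_aut f).
Proof.
apply/group_setP; split=> [|s1 s2].
  by rewrite inE; apply/and3P; split; apply/forallP=> x; rewrite /= !perm1 ?eqxx.
rewrite !inE => /and3P[/forallP a1 /forallP v1 /forallP e1].
move=> /and3P[/forallP a2 /forallP v2 /forallP e2].
apply/and3P; split; apply/forallP=> x; rewrite /= !permM.
- have /and3P[/eqP ao1 /eqP at1 /eqP ai1] := a1 x.
  have /and3P[/eqP -> /eqP -> /eqP ->] := a2 (s1.2 x).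
  by rewrite ao1 at1 ai1 !eqxx.
- by rewrite (eqP (v2 _)).
- by rewrite (eqP (e2 _)).
Qed.

Canonical cover_aut_group (Y X : sgraph) (f : ghom Y X) :=
  Group (cover_aut_group_set f).

Definition is_galois (Y X : sgraph) (f : ghom Y X) : Prop :=
  [/\ is_cover f, connected Y &
      forall v, {in fiber f v &, forall w w',
        exists2 s, s \in cover_aut f & s.1 w = w'}].

Record tower := Tower {
  level :> nat -> sgraph;
  tstep : forall n, ghom (level n.+1) (level n)
}.

Fixpoint tcomp (T : tower) (n : nat) : ghom (T n) (T 0) :=
  match n with
  | 0 => ghom_id (T 0)
  | m.+1 => ghom_comp (tcomp T m) (tstep T m)
  end.

(* A tower above its bottom level [T 0]. *)
Definition is_Zl_tower (l : nat) (T : tower) : Prop :=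
  [/\ forall n, connected (T n),
      forall n, is_cover (tstep T n) &
      forall n, 0 < n ->
        is_galois (tcomp T n) /\ cover_aut (tcomp T n) \isog Zp (l ^ n)].

Section Pullback.
Variables (Y1 Y2 X : sgraph) (p1 : ghom Y1 X) (p2 : ghom Y2 X).

Definition pb_vertex : finType :=
  {w : vertex Y1 * vertex Y2 | hV p1 w.1 == hV p2 w.2}.

Definition pb_dedge : finType :=
  {e : dedge Y1 * dedge Y2 | hE p1 e.1 == hE p2 e.2}.

Lemma pb_org_subproof (e : pb_dedge) :
  hV p1 (org (val e).1) == hV p2 (org (val e).2).
Proof. by rewrite -!hom_org (eqP (valP e)). Qed.

Lemma pb_trm_subproof (e : pb_dedge) :
  hV p1 (trm (val e).1) == hV p2 (trm (val e).2).
Proof. by rewrite -!hom_trm (eqP (valP e)). Qed.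

Lemma pb_inv_subproof (e : pb_dedge) :
  hE p1 (einv (val e).1) == hE p2 (einv (val e).2).
Proof. by rewrite -!hom_inv (eqP (valP e)). Qed.

Definition pb_org (e : pb_dedge) : pb_vertex :=
  exist _ (org (val e).1, org (val e).2) (pb_org_subproof e).

Definition pb_trm (e : pb_dedge) : pb_vertex :=
  exist _ (trm (val e).1, trm (val e).2) (pb_trm_subproof e).

Definition pb_inv (e : pb_dedge) : pb_dedge :=
  exist _ (einv (val e).1, einv (val e).2) (pb_inv_subproof e).

Lemma pb_inv_neq e : pb_inv e != e.
Proof.
apply/eqP => /(congr1 (fun x : pb_dedge => (val x).1)) /= /eqP.
by rewrite (negPf (einv_neq _)).
Qed.

Lemma pb_invK : involutive pb_inv.
Proof. by move=> e; apply: val_inj; rewrite /= !einvK; case: (val e). Qed.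

Lemma pb_org_inv e : pb_org (pb_inv e) = pb_trm e.
Proof. by apply: val_inj; rewrite /= !org_inv. Qed.

Lemma pb_trm_inv e : pb_trm (pb_inv e) = pb_org e.
Proof. by apply: val_inj; rewrite /= !trm_inv. Qed.

Definition pullback : sgraph :=
  SGraph pb_inv_neq pb_invK pb_org_inv pb_trm_inv.

Definition pb_fst : ghom pullback Y1 :=
  @GHom pullback Y1 (fun w => (val w).1) (fun e => (val e).1)
    (fun=> erefl) (fun=> erefl) (fun=> erefl).
End Pullback.

Section PullbackMap.
Variables (Y X Z2 Z1 : sgraph) (p : ghom Y X) (q : ghom Z1 X) (g : ghom Z2 Z1).

Let P2 := pullback p (ghom_comp q g).
Let P1 := pullback p q.

Definition pbm_V (w : vertex P2) : vertex P1 :=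
  exist _ ((val w).1, hV g (val w).2) (valP w).

Definition pbm_E (e : dedge P2) : dedge P1 :=
  exist _ ((val e).1, hE g (val e).2) (valP e).

Lemma pbm_org e : org (pbm_E e) = pbm_V (org e).
Proof. by apply: val_inj; rewrite /= hom_org. Qed.

Lemma pbm_trm e : trm (pbm_E e) = pbm_V (trm e).
Proof. by apply: val_inj; rewrite /= hom_trm. Qed.

Lemma pbm_inv e : einv (pbm_E e) = pbm_E (einv e).
Proof. by apply: val_inj; rewrite /= hom_inv. Qed.

Definition pb_map : ghom P2 P1 := GHom pbm_org pbm_trm pbm_inv.
End PullbackMap.

(* The bottom level is Y itself, not the isomorphic pullback of Y along the
   identity of [T 0]. *)
Definition pb_level (Y : sgraph) (T : tower) (p : ghom Y (T 0)) (n : nat) :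
  sgraph :=
  match n with
  | 0 => Y
  | m.+1 => pullback p (tcomp T m.+1)
  end.

Definition pb_step (Y : sgraph) (T : tower) (p : ghom Y (T 0)) (n : nat) :
  ghom (pb_level p n.+1) (pb_level p n) :=
  match n with
  | 0 => pb_fst p (tcomp T 1)
  | m.+1 => pb_map p (tcomp T m.+1) (tstep T m.+1)
  end.

Definition pb_tower (Y : sgraph) (T : tower) (p : ghom Y (T 0)) : tower :=
  Tower (pb_step p).

Definition iwasawa_invariants (l : nat) (T : tower) (mu lambda : nat) : Prop :=
  exists (nu : int) (n0 : nat), forall n, n0 <= n ->
    ((logn l #|spanning_trees (T n)|)%:Z
       = (mu * l ^ n)%:Z + (lambda * n)%:Z + nu)%R.

(* Main.v *)
(* The ratio of the numbers of spanning trees at two consecutive levels is, up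
   to the factor l, the product of f(z^k) over k prime to l, where z is a
   primitive l^n-th root of unity and f is the determinant of the Laplacian of
   the base graph twisted by the voltages (Frobenius classes) of its edges.
   Since 1 - z is a uniformizer above l, this product has l-adic valuation the
   order d of f mod l at x = 1, as soon as d < phi(l^n).  Hence mu = 0 if and
   only if d stays below phi(l^n) for large n, and then lambda + 1 = d.  The
   twisted Laplacian of Y is that of X tensored with the regular representation
   of an l-group, which is unipotent in characteristic l; thus
   f_Y = f_X ^ [Y:X] mod l, and d is multiplied by [Y:X]. *)
Require Import Defs.
From mathcomp Require Import all_boot all_order all_algebra.
From mathcomp Require Import all_fingroup all_solvable all_field all_character.
From mathcomp Require Import ring zify.

Set Implicit Arguments.
Unset Strict Implicit.
Unset Printing Implicit Defensive.

Import GroupScope Order.TTheory GRing.Theory Num.Theory.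
Local Open Scope ring_scope.

(** * Determinants indexed by finite types *)

(** The Laplacian is singular, so it is shifted to ['X] plus the Laplacian, and trees are read off
    the coefficient of ['X]: the number of vertices times the number of trees. The vertex counts of
    two consecutive levels differ by l, which is the extra factor l in the ratio.

    No limit over the tower is formed. The voltages are natural numbers chosen anew for each n and
    valid for the levels n and n + 1 only, so f depends on n. A single n suffices: once phi exceeds
    both [Y:X] (lambda_X + 1) and lambda_Y + 1, the growth mu phi + lambda of the valuation from
    level n to n + 1 tells for each tower which alternative holds.

    Divisibility by 1 - z^k is expressed by quotients lying in [Aint], in place of ideals or l-adic
    valuations.

    Both factorizations of Laplacians, over the characters of a cyclic group and over an l-group in
    characteristic l, are instances of one block triangularization. Determinants are indexed by
    finite types because the index sets are vertex sets and their products with fibres. *)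

Definition fdet (R : comNzRingType) (T : finType) (A : T -> T -> R) : R :=
  \sum_(s : {perm T}) (-1) ^+ s * \prod_i A i (s i).

Section ConjPerm.
Variables (T T' : finType) (h : T -> T') (g : T' -> T).
Hypotheses (hK : cancel h g) (gK : cancel g h).

Let conj_inj (s : {perm T}) : injective (fun x => h (s (g x))).
Proof. exact: inj_comp (can_inj hK) (inj_comp perm_inj (can_inj gK)). Qed.

Definition conj_perm (s : {perm T}) : {perm T'} := perm (@conj_inj s).

Lemma odd_conj_perm s : conj_perm s = s :> bool.
Proof.
have conjM s1 s2 : conj_perm (s1 * s2)%g = (conj_perm s1 * conj_perm s2)%g.
  by apply/permP=> x; rewrite !(permE, permM) hK.
have [ts -> _] := prod_tpermP s; elim: ts => [|[x y] ts IHts].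
  rewrite !big_nil odd_perm1; suff -> : conj_perm 1 = 1%g by rewrite odd_perm1.
  by apply/permP=> x; rewrite permE !perm1 gK.
rewrite !big_cons conjM !odd_permM {}IHts; congr (_ (+) _) => /=.
have -> : conj_perm (tperm x y) = tperm (h x) (h y).
  apply/permP=> z; rewrite permE -{2}[z]gK.
  by rewrite (inj_tperm _ _ _ (can_inj hK)).
by rewrite !odd_tperm (can_eq hK).
Qed.
End ConjPerm.

Section FDet.
Variable R : comNzRingType.
Implicit Types T : finType.

Lemma eq_fdet T (A B : T -> T -> R) : A =2 B -> fdet A = fdet B.
Proof.
by move=> eqAB; apply: eq_bigr => s _; under eq_bigr do rewrite eqAB.
Qed.

Lemma fdet_reindex T T' (h : T -> T') (A : T' -> T' -> R) :
  bijective h -> fdet (fun x y => A (h x) (h y)) = fdet A.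
Proof.
move=> bij_h; have [g hK gK] := bij_h; rewrite /fdet.
rewrite [RHS](reindex (conj_perm hK gK)) /=.
  apply: eq_bigr => s _; rewrite odd_conj_perm; congr (_ * _).
  rewrite [RHS](reindex h) /=; last exact: onW_bij.
  by apply: eq_bigr => x _; rewrite permE hK.
apply: onW_bij; exists (conj_perm gK hK) => s; apply/permP=> x.
  by rewrite !permE !hK.
by rewrite !permE !gK.
Qed.

Lemma fdet_ord n (A : 'M[R]_n) : fdet A = \det A.
Proof. by []. Qed.

Definition fmx T (A : T -> T -> R) : 'M[R]_#|T| :=
  \matrix_(i, j) A (enum_val i) (enum_val j).

Lemma fdetE T (A : T -> T -> R) : fdet A = \det (fmx A).
Proof.
rewrite -fdet_ord -(fdet_reindex A (@enum_val_bij T)).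
by apply: eq_fdet => i j; rewrite mxE.
Qed.

Lemma fdetM T (A B : T -> T -> R) :
  fdet (fun x y => \sum_z A x z * B z y) = fdet A * fdet B.
Proof.
rewrite !fdetE -det_mulmx; congr (\det _); apply/matrixP=> i j; rewrite !mxE.
rewrite (reindex _ (onW_bij _ (@enum_val_bij T))).
by apply: eq_bigr => k _; rewrite !mxE.
Qed.

Lemma fdet1 T : fdet (fun x y : T => (x == y)%:R) = 1 :> R.
Proof.
rewrite fdetE -[RHS](det1 R #|T|); congr (\det _).
by apply/matrixP=> i j; rewrite !mxE (inj_eq enum_val_inj).
Qed.

(** Multiplying the relation by the adjugate leaves the determinant times [c], over any commutative
    ring. *)
Lemma fdet_kernel T (A : T -> T -> R) (c : T -> R) (v : T) :
  (forall x, \sum_y A x y * c y = 0) -> fdet A * c v = 0.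
Proof.
move=> Ac0; pose u : 'cV[R]_#|T| := \col_i c (enum_val i).
have Au0 : fmx A *m u = 0.
  apply/matrixP=> i j; rewrite !mxE -[RHS](Ac0 (enum_val i)).
  rewrite [RHS](reindex _ (onW_bij _ (@enum_val_bij T))) /=.
  by apply: eq_bigr => k _; rewrite !mxE.
have : \adj (fmx A) *m (fmx A *m u) = 0 by rewrite Au0 mulmx0.
rewrite mulmxA mul_adj_mx => /matrixP/(_ (enum_rank v) 0).
by rewrite mul_scalar_mx !mxE enum_rankK fdetE.
Qed.

Lemma fdet_sum T1 T2 (A : T1 + T2 -> T1 + T2 -> R) :
  (forall x y, A (inl x) (inr y) = 0) ->
  fdet A = fdet (fun x y => A (inl x) (inl y))
         * fdet (fun x y => A (inr x) (inr y)).
Proof.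
move=> A0; pose h (i : 'I_(#|T1| + #|T2|)) : T1 + T2 :=
  match split i with inl j => inl (enum_val j) | inr j => inr (enum_val j) end.
have bij_h : bijective h.
  exists (fun x => match x with inl y => lshift _ (enum_rank y)
                   | inr y => rshift _ (enum_rank y) end) => [i | [x | x]].
  - by rewrite /h; case: splitP => j def_i; apply: val_inj;
      rewrite /= enum_valK.
  - by rewrite /h (unsplitK (inl _)) enum_rankK.
  - by rewrite /h (unsplitK (inr _)) enum_rankK.
rewrite -(fdet_reindex A bij_h) [in RHS]fdetE [X in _ = _ * X]fdetE.
pose D := \matrix_(i < #|T2|, j < #|T1|) A (inr (enum_val i)) (inl (enum_val j)).
transitivity (\det (block_mx (fmx (fun x y => A (inl x) (inl y))) 0 D
                             (fmx (fun x y => A (inr x) (inr y))))).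
  rewrite -fdet_ord; apply: eq_fdet => i j; rewrite /h.
  rewrite -[i]splitK -[j]splitK !unsplitK.
  case: (split i) (split j) => i' [] j' /=.
  - by rewrite block_mxEul mxE.
  - by rewrite block_mxEur mxE A0.
  - by rewrite block_mxEdl mxE.
  - by rewrite block_mxEdr mxE.
by rewrite det_lblock.
Qed.

(** Grouping the pairs by their second coordinate instead of the first makes the matrix block
    triangular; the induction splits off the index [ord0]. *)
Lemma fdet_triangular T m (A : T -> T -> 'M[R]_m) :
  (forall x y, is_trig_mx (A x y)) ->
  fdet (fun x y : T * 'I_m => A x.1 y.1 x.2 y.2)
    = \prod_i fdet (fun x y => A x y i i).
Proof.
elim: m A => [|m IHm] A trigA.
  rewrite big_ord0 fdetE; apply/eqP.
  have T0 : #|{: T * 'I_0}| = 0 by rewrite card_prod card_ord muln0.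
  by move: (fmx _); rewrite T0 => M; rewrite det_mx00.
pose h (z : T + T * 'I_m) : T * 'I_m.+1 :=
  match z with inl x => (x, ord0) | inr x => (x.1, lift ord0 x.2) end.
have bij_h : bijective h.
  exists (fun x => if unlift ord0 x.2 is Some i then inr (x.1, i) else inl x.1).
    by case=> [x | [x i]] /=; rewrite ?unlift_none ?liftK.
  by case=> x i /=; case: unliftP => [j|] ->.
rewrite -(fdet_reindex _ bij_h) fdet_sum => [|x [y i]]; last first.
  by rewrite /=; apply: (is_trig_mxP (trigA _ _)).
rewrite big_ord_recl; congr (_ * _).
pose A' x y := \matrix_(i < m, j < m) A x y (lift ord0 i) (lift ord0 j).
transitivity (fdet (fun x y : T * 'I_m => A' x.1 y.1 x.2 y.2)).
  by apply: eq_fdet => x y; rewrite mxE.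
rewrite IHm => [|x y]; last first.
  by apply/is_trig_mxP=> i j ltij; rewrite mxE (is_trig_mxP (trigA x y)).
by apply: eq_bigr => i _; apply: eq_fdet => x y; rewrite mxE.
Qed.

Lemma fdet_block T m (A : T -> T -> 'M[R]_m) (S S' : 'M[R]_m) :
    S *m S' = 1%:M -> (forall x y, is_trig_mx (S *m A x y *m S')) ->
  fdet (fun x y : T * 'I_m => A x.1 y.1 x.2 y.2)
    = \prod_i fdet (fun x y => (S *m A x y *m S') i i).
Proof.
(* [D M] is the tensor product of the identity on [T] with [M], so that conjugating by [D S]
   conjugates every block by [S]. *)
move=> SS' /fdet_triangular <-; pose D (M : 'M[R]_m) (x y : T * 'I_m) :=
  M x.2 y.2 *+ (x.1 == y.1).
have sum_pair (F : T * 'I_m -> R) : \sum_z F z = \sum_x \sum_k F (x, k).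
  by rewrite pair_bigA; apply: eq_bigr => -[].
have sumDl M (F : T * 'I_m -> R) x :
    \sum_z D M x z * F z = \sum_k M x.2 k * F (x.1, k).
  rewrite (sum_pair (fun z => D M x z * F z)).
  rewrite (bigD1 x.1) //= [X in _ + X]big1 => [|z /negPf nz].
    by rewrite addr0; apply: eq_bigr => k _; rewrite /D eqxx.
  by apply: big1 => k _; rewrite /D eq_sym nz mul0r.
have sumDr M (F : T * 'I_m -> R) y :
    \sum_z F z * D M z y = \sum_k F (y.1, k) * M k y.2.
  rewrite (sum_pair (fun z => F z * D M z y)).
  rewrite (bigD1 y.1) //= [X in _ + X]big1 => [|z /negPf nz].
    by rewrite addr0; apply: eq_bigr => k _; rewrite /D eqxx.
  by apply: big1 => k _; rewrite /D nz mulr0.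
have DD : fdet (D S) * fdet (D S') = 1.
  rewrite -fdetM -[RHS](fdet1 (T * 'I_m)%type); apply: eq_fdet => -[x i] [y j].
  rewrite sumDl /D /= xpair_eqE; case: eqP => _ /=; last first.
    by apply: big1 => k _; rewrite mulr0.
  by move/matrixP: SS' => /(_ i j); rewrite !mxE.
transitivity (fdet (D S) * fdet (fun x y : T * 'I_m => A x.1 y.1 x.2 y.2)
              * fdet (D S')); first by rewrite mulrAC DD mul1r.
rewrite -!fdetM; apply: eq_fdet => x y; rewrite sumDr mxE.
by apply: eq_bigr => k _; rewrite sumDl mxE.
Qed.

End FDet.

Lemma fdet_map (R R' : comNzRingType) (f : {rmorphism R -> R'}) (T : finType)
    (A : T -> T -> R) :
  f (fdet A) = fdet (fun x y => f (A x y)).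
Proof.
rewrite rmorph_sum; apply: eq_bigr => s _.
by rewrite rmorphM rmorph_sign rmorph_prod.
Qed.

Local Open Scope nat_scope.

(** * The matrix-tree theorem *)

Section Reach.
Variables (X : sgraph) (B : {set vertex X}) (A : {set dedge X}).
Implicit Types (S : {set vertex X}) (v : vertex X).

(** The least fixed point [reach] consists of the vertices from which a path in [A] leads into [B].
    On it [reach_rank] is one more than the distance to [B]; this is the decreasing measure used
    against cycles below. *)
Definition reach_step S : {set vertex X} :=
  [set v | (v \in B) || [exists e in A, (org e == v) && (trm e \in S)]].

Definition reach := fixset reach_step.
Definition reach_rank v := fix_order reach_step v.

Lemma reach_step_mono : {homo reach_step : S S' / S \subset S'}.
Proof.
move=> S S' /subsetP sSS'; apply/subsetP=> v; rewrite !inE.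
case/orP=> [-> // | /exists_inP[e Ae /andP[ev /sSS' Se]]].
by apply/orP; right; apply/exists_inP; exists e; rewrite // ev.
Qed.

Lemma reachE v :
  (v \in reach) = (v \in B) || [exists e in A, (org e == v) && (trm e \in reach)].
Proof. by rewrite -{1}/(reach) /reach -[in LHS](fixsetK reach_step_mono) inE. Qed.

Lemma reach_base v : v \in B -> v \in reach.
Proof. by rewrite reachE => ->. Qed.

Lemma reach_edge e : e \in A -> trm e \in reach -> org e \in reach.
Proof.
move=> Ae te; rewrite reachE; apply/orP; right.
by apply/exists_inP; exists e; rewrite // eqxx.
Qed.

Lemma reach_ind S :
    {subset B <= S} -> (forall e, e \in A -> trm e \in S -> org e \in S) ->
  {subset reach <= S}.
Proof.
move=> sBS clS; suff it k : {subset iter k reach_step set0 <= S} by apply: it.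
elim: k => [|k IHk] v; first by rewrite inE.
rewrite /= inE => /orP[/sBS // | /exists_inP[e Ae /andP[/eqP <- /IHk]]].
exact: clS.
Qed.

Lemma reach_rankP v : v \in reach ->
  v \in B \/ exists2 e, e \in A & org e = v /\ reach_rank (trm e) < reach_rank v.
Proof.
move=> rv; have: v \in iter (reach_rank v) reach_step set0.
  by rewrite in_iter_fix_orderE.
case def_k: (reach_rank v) => [|k]; first by rewrite inE.
rewrite /= inE => /orP[-> | /exists_inP[e Ae /andP[/eqP ev te]]]; first by left.
by right; exists e => //; split=> //; rewrite ltnS (fix_order_small reach_step_mono).
Qed.

Lemma ranked_reach (d : vertex X -> nat) :
    (forall v, v \in B \/ exists2 e, e \in A & org e = v /\ d (trm e) < d v) ->
  reach = setT.
Proof.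
move=> dP; apply/setP=> v; rewrite inE.
elim: {v}_.+1 {-2}v (ltnSn (d v)) => // k IHk v lt_vk.
have [/reach_base // | [e Ae [ev lt_ev]]] := dP v; rewrite -ev in lt_vk lt_ev *.
by apply: reach_edge Ae _; apply: IHk; apply: leq_trans lt_ev _.
Qed.
End Reach.

Section MatrixTree.
Variable X : sgraph.
Local Notation V := (vertex X).
Local Notation E := (dedge X).

(* Expanding every row of [u + Laplacian], a choice stops at a vertex (the
   summand [u]) or follows an edge out of it. *)
Local Notation choice := {ffun V -> option E}.
Implicit Types (f g : choice) (v w r : V) (e : E) (A : {set E}).

Definition admissible v (o : option E) :=
  if o is Some e then org e == v else true.

Definition stops f : {set V} := [set v | f v == None].
Definition moves f : {set E} := [set e | f (org e) == Some e].
Definition support f : {set E} := [set e | (e \in moves f) || (einv e \in moves f)].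

(** For an admissible [f], following the chosen edges from any vertex ends at a stop: [f] is a
    spanning forest oriented towards its roots [stops f]. *)
Definition halting f := reach (stops f) (moves f) == setT.

Lemma halting_ind f (S : {set V}) : halting f ->
    (forall v, f v = None -> v \in S) ->
    (forall e, f (org e) = Some e -> trm e \in S -> org e \in S) ->
  forall v, v \in S.
Proof.
move=> /eqP hf S0 S1 v; have: v \in reach (stops f) (moves f) by rewrite hf inE.
apply: (reach_ind (S := S)) => [w | e]; rewrite inE => /eqP.
  exact: S0.
exact: S1.
Qed.

Lemma halting_rank f e :
  halting f -> f (org e) = Some e ->
  reach_rank (stops f) (moves f) (trm e) < reach_rank (stops f) (moves f) (org e).
Proof.
move=> /eqP hf fe; have /reach_rankP : org e \in reach (stops f) (moves f).
  by rewrite hf inE.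
rewrite inE fe => -[// | [e' ]]; rewrite inE => /eqP fe' [e'e].
by move: fe'; rewrite e'e fe => -[->].
Qed.

Lemma halting_no_loop f e : halting f -> f (org e) = Some e -> trm e != org e.
Proof.
move=> hf fe; apply/eqP => loop; have := halting_rank hf fe.
by rewrite loop ltnn.
Qed.

Section Expansion.
Variable R : comNzRingType.
Local Open Scope ring_scope.

(** The weights [c] twist the adjacency part only and the degrees stay those of [X], which is the
    shape of the Laplacian of a cover seen through a character. *)
Definition wlap (u : R) (c : E -> R) v w : R :=
  (u + #|star v|%:R) *+ (v == w) - \sum_(e | (org e == v) && (trm e == w)) c e.

Definition choice_row (u : R) v (o : option E) w : R :=
  if o is Some e then (v == w)%:R - (trm e == w)%:R else u *+ (v == w).

Lemma wlap_rows u v w :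
  wlap u (fun=> 1) v w = \sum_(o | admissible v o) choice_row u v o w.
Proof.
rewrite [RHS](bigD1 None) //= (reindex_omap Some id) => [|[e|]] //=.
rewrite (eq_bigl (fun e => org e == v)) => [|e]; last by rewrite eqxx !andbT.
rewrite sumrB addrA /wlap; congr (_ - _).
  rewrite mulrnDl; congr (_ + _); rewrite sumr_const -mulrnA mulnC mulrnA.
  by congr (_ *+ _); apply: eq_card => e; rewrite !inE.
by rewrite big_mkcondr; apply: eq_bigr => e _; case: eqP.
Qed.

(* Either the identity is the only permutation contributing to the determinant,
   or the indicator of the vertices that never stop is in the kernel. *)
Lemma fdet_choice u f :
    (forall v, admissible v (f v)) ->
  fdet (fun v w => choice_row u v (f v) w)
    = if halting f then u ^+ #|stops f| else 0.
Proof.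
move=> adm_f; have fS v e : f v = Some e -> org e = v.
  by move=> fv; have := adm_f v; rewrite fv => /eqP.
case: ifPn => [hf | /eqP/setP nhf].
  rewrite /fdet (bigD1 1%g) //= odd_perm1 expr0 mul1r [X in _ + X]big1 ?addr0 => [|s].
    rewrite (bigID (mem (stops f))) /= [X in _ * X]big1 ?mulr1.
      rewrite -prodr_const; apply: eq_bigr => v.
      by rewrite inE perm1 => /eqP ->; rewrite /= eqxx.
    move=> v; rewrite inE perm1; case fv: (f v) => [e|] // _ /=.
    have ev := fS _ _ fv; rewrite eqxx -{1}ev in fv *.
    by rewrite -ev (negPf (halting_no_loop hf fv)) subr0.
  (* If no factor vanishes, [s] fixes every stop. Fixed points then spread backwards along chosen
     edges: [s] sends [org e] to [org e] or [trm e], and injectivity excludes [trm e] once that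
     vertex is fixed. *)
  move=> s1; have [v sv | s_id] := pickP (fun v => choice_row u v (f v) (s v) == 0).
    by rewrite (bigD1 v) //= (eqP sv) mul0r mulr0.
  case/eqP: s1; apply/permP=> v; rewrite perm1; apply/eqP.
  suff: v \in [set v | s v == v] by rewrite inE.
  move: v; apply: (halting_ind hf) => [v fv | e fe]; rewrite !inE.
    by have := s_id v; rewrite fv /= [v == _]eq_sym; case: (s v == v); rewrite //= mulr0n eqxx.
  move=> /eqP se; have := s_id (org e); rewrite fe /=.
  case: (org e =P s (org e)) => [<- //|_].
  case: (trm e =P s (org e)) => [tes|_]; last by rewrite subrr eqxx.
  by rewrite -tes (perm_inj (etrans se tes)) eqxx.
pose c v : R := (v \notin reach (stops f) (moves f))%:R.
have [v nv] : exists v, v \notin reach (stops f) (moves f).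
  apply/existsP; rewrite -negb_forall; apply/negP=> /forallP hf.
  by case: nhf => v; rewrite hf inE.
have cv : c v = 1 by rewrite /c nv.
rewrite -[LHS]mulr1 -cv; apply: fdet_kernel => x.
have sum1 w : \sum_y (w == y)%:R * c y = c w.
  rewrite (bigD1 w) //= eqxx mul1r big1 ?addr0 // => y /negPf.
  by rewrite eq_sym => ->; rewrite mul0r.
case fx: (f x) => [e|] /=.
  under eq_bigr do rewrite mulrBl; rewrite sumrB !sum1 -(fS _ _ fx) /c.
  rewrite [org e \in _]reachE inE (fS _ _ fx) fx /=.
  suff -> : [exists e0 in moves f, (org e0 == x) && (trm e0 \in reach (stops f) (moves f))]
      = (trm e \in reach (stops f) (moves f)) by rewrite subrr.
  apply/exists_inP/idP => [[e']|te]; last first.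
    by exists e; rewrite ?inE (fS _ _ fx) ?fx ?eqxx.
  by rewrite inE => /eqP fe' /andP[/eqP e'x]; move: fe'; rewrite e'x fx => -[->].
under eq_bigr do rewrite -mulr_natr -mulrA.
by rewrite -mulr_sumr sum1 /c reach_base ?mulr0 // inE fx.
Qed.

(** Multilinearity in the rows gives a sum over choices, of which only the rooted spanning forests
    survive. *)
Lemma fdet_wlap u :
  fdet (wlap u (fun=> 1))
    = \sum_(f : {ffun V -> option E} | [forall v, admissible v (f v)] && halting f) u ^+ #|stops f|.
Proof.
transitivity (\sum_(f : {ffun V -> option E} | [forall v, admissible v (f v)])
   fdet (fun v w => choice_row u v (f v) w)).
  rewrite /fdet exchange_big /=; apply: eq_bigr => s _; rewrite -mulr_sumr.
  congr (_ * _); under eq_bigr do rewrite wlap_rows.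
  by rewrite bigA_distr_big_dep; apply: eq_bigl => f; apply: eq_forallb.
by rewrite [RHS]big_mkcondr; apply: eq_bigr => f /forallP /(@fdet_choice u).
Qed.
End Expansion.

Definition arborescences :=
  [set f : {ffun V -> option E} | [&& [forall v, admissible v (f v)], halting f & #|stops f| == 1]].

Lemma arborescenceP f : reflect
  (exists r, [/\ forall v e, f v = Some e -> org e = v, halting f & stops f = [set r]])
  (f \in arborescences).
Proof.
rewrite inE; apply: (iffP and3P) => [[/forallP af hf /cards1P[r fr]] | [r [af hf fr]]].
  by exists r; split=> // v e fv; have := af v; rewrite fv => /eqP.
split=> //; last by rewrite fr cards1.
by apply/forallP=> v; case fv: (f v) => [e|] //=; rewrite (af _ _ fv).
Qed.

Lemma support_connected f : f \in arborescences -> connected_by (support f).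
Proof.
case/arborescenceP=> r [_ hf fr].
have toR v : connect (adj (support f)) v r /\ connect (adj (support f)) r v.
  suff : v \in [set v | connect (adj (support f)) v r && connect (adj (support f)) r v].
    by rewrite inE => /andP[].
  move: v; apply: (halting_ind hf) => [v fv | e fe].
    suff: v \in stops f by rewrite fr !inE => /eqP ->; rewrite connect0.
    by rewrite inE fv.
  rewrite !inE => /andP[te et]; apply/andP; split.
    apply: connect_trans te; apply: connect1; apply/exists_inP; exists e.
      by rewrite !inE fe eqxx.
    by rewrite !eqxx.
  apply: connect_trans et _; apply: connect1; apply/exists_inP; exists (einv e).
    by rewrite !inE einvK fe eqxx orbT.
  by rewrite org_inv trm_inv !eqxx.
apply/andP; split; first by apply/card_gt0P; exists r.
apply/forallP=> v; apply/forallP=> w.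
exact: connect_trans (toR v).1 (toR w).2.
Qed.

(** On a circuit, let [e] start at a vertex of maximal rank. Ranks drop along chosen edges, so [e]
    itself is the edge chosen at its origin, and the edge before [e] can only be chosen in reverse.
    It is then the inverse of [e], and the circuit backtracks. *)
Lemma support_acyclic f : f \in arborescences -> acyclic (support f).
Proof.
case/arborescenceP=> r [_ hf fr]; apply/acyclicP=> c /allP Ac; apply/negP.
case/and3P=> c0 cyc _; pose d := reach_rank (stops f) (moves f).
have [e0 ce0] : exists e0, e0 \in c by case: c c0 {Ac cyc} => // e c; exists e; rewrite mem_head.
have [e ce max_c] := @arg_maxnP _ e0 (mem c) (fun e => d (org e)) ce0.
have max_e e1 : e1 \in c -> d (org e1) <= d (org e) by exact: max_c.
have := next_cycle cyc ce => /andP[/eqP e_next _].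
have := prev_cycle cyc ce; set e' := prev c e => /andP[/eqP e'_e ne_e].
have ce' : e' \in c by rewrite mem_prev.
have fe : f (org e) = Some e.
  have := Ac _ ce; rewrite !inE => /orP[/eqP // | ].
  rewrite org_inv => /eqP fte; have := halting_rank hf (e := einv e).
  rewrite org_inv trm_inv fte => /(_ erefl); rewrite ltnNge e_next.
  by rewrite max_e // mem_next.
have := Ac _ ce'; rewrite !inE org_inv e'_e fe => /orP[/eqP fe' | /eqP[ee']].
  by have := halting_rank hf fe'; rewrite e'_e ltnNge max_e.
by rewrite ee' eqxx in ne_e.
Qed.

Lemma support_tree f : f \in arborescences -> spanning_tree (support f).
Proof.
move=> Af; rewrite /spanning_tree support_connected // support_acyclic // !andbT.
by apply/forall_inP=> e; rewrite !inE einvK orbC.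
Qed.

(** Induction from the root along [g]. If [f] did not choose the edge [e] that [g] chooses, it would
    choose [einv e] at [trm e]; there [f] and [g] agree, so [g] would choose both [e] and its
    inverse. *)
Lemma support_inj : {in arborescences &, injective (fun f => (stops f, support f))}.
Proof.
move=> f g /arborescenceP[r [af hf fr]] /arborescenceP[r' [ag hg gr]] [eq_st eq_sup].
apply/ffunP=> v; apply/eqP; suff: v \in [set v | f v == g v] by rewrite inE.
move: v; apply: (halting_ind hg) => [v gv | e ge].
  have : v \in stops g by rewrite inE gv.
  by rewrite -eq_st !inE gv.
rewrite !inE => /eqP fte; have : e \in support g by rewrite !inE ge eqxx.
rewrite -eq_sup !inE => /orP[/eqP -> | ]; first by rewrite ge.
rewrite org_inv fte => /eqP gte; have := halting_rank hg ge.
have := halting_rank hg (e := einv e); rewrite org_inv trm_inv gte => /(_ erefl).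
by move=> lt1 /(ltn_trans lt1); rewrite ltnn.
Qed.

(** Breadth-first search: every vertex other than [r] picks an edge of [A] that brings it closer to
    [r]. *)
Lemma arborescence_exists A r : connected_by A ->
  exists2 f, f \in arborescences & stops f = [set r] /\ moves f \subset A.
Proof.
move=> /andP[_ /forallP conA]; pose d := reach_rank [set r] A.
have reachA : reach [set r] A = setT.
  apply/setP=> v; rewrite inE; have /forallP/(_ r)/connectP[p] := conA v.
  elim: p v => [|w p IHp] v /=; first by move=> _ ->; rewrite reach_base ?set11.
  move=> /andP[/exists_inP[e Ae /andP[/eqP <- /eqP <-]] pA def_r].
  by apply: reach_edge Ae (IHp _ pA def_r).
pose f := [ffun v => if v == r then None else
  [pick e in A | (org e == v) && (d (trm e) < d v)]].
have fP v : v != r -> exists2 e, f v = Some e & [/\ e \in A, org e = v & d (trm e) < d v].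
  move=> vr; rewrite ffunE (negPf vr); case: pickP => [e /and3P[Ae /eqP ev lt_ev]|].
    by exists e.
  have : v \in reach [set r] A by rewrite reachA inE.
  case/reach_rankP=> [|[e Ae [ev lt_ev]]]; first by rewrite inE (negPf vr).
  by move=> /(_ e); rewrite Ae ev eqxx lt_ev.
have fr : stops f = [set r].
  apply/setP=> v; rewrite !inE; have [->|/fP[e -> _]] // := eqVneq v r.
  by rewrite ffunE eqxx.
have fN v e : f v = Some e -> v != r.
  by move=> fv; rewrite -in_set1 -fr inE fv.
have af v e : f v = Some e -> org e = v.
  by move=> fv; have [e'] := fP v (fN _ _ fv); rewrite fv => -[<-] [].
exists f; last first.
  split=> //; apply/subsetP=> e; rewrite inE => /eqP fe.
  by have [e'] := fP _ (fN _ _ fe); rewrite fe => -[<-] [].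
apply/arborescenceP; exists r; split=> //; apply/eqP.
apply: (ranked_reach (d := d)) => v; rewrite fr inE.
have [->|/fP[e fv [_ ev lt_ev]]] := eqVneq v r; [by left | right].
by exists e; rewrite // inE ev fv.
Qed.
End MatrixTree.
Arguments wlap X {R}.

Section TreeCount.
Variable X : sgraph.
Local Notation V := (vertex X).
Local Notation E := (dedge X).
Implicit Types (A B : {set E}) (e : E) (v w : V).

Lemma lift_path A v p : path (adj A) v p ->
  exists s : seq E, [/\ all (mem A) s, map trm s = p & map org s = belast v p].
Proof.
elim: p v => [|w p IHp] v /=; first by exists [::].
case/andP=> /exists_inP[e Ae /andP[/eqP ev /eqP ew]] /IHp[s [As ts os]].
by exists (e :: s); rewrite /= Ae As ts os ev ew.
Qed.

(** Backtracking later in the path would repeat a terminal vertex; only a reversal of the initial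
    edge [e] has to be excluded separately. *)
Lemma nonbacktracking_path (s : seq E) e :
    map org s = belast (trm e) (map trm s) -> uniq (trm e :: map trm s) ->
    einv e \notin s ->
  path (fun e e' => (trm e == org e') && (e' != einv e)) e s.
Proof.
elim: s e => //= e1 s IHs e [e1e os] /and3P[/norP[ne ns] n1 us].
rewrite inE negb_or => /andP[ne1 _]; rewrite e1e eqxx eq_sym ne1 /=.
apply: IHs; rewrite ?n1 //; apply: contra ns => s1; apply/mapP.
by exists (einv e1); rewrite // trm_inv.
Qed.

(** An edge of [A] outside [B] would close a simple path of [B] into a circuit of [A]; stability of
    [B] under inversion keeps the inverse of that edge out of the path. *)
Lemma connected_sub_acyclic A B :
    B \subset A -> (forall e, e \in B -> einv e \in B) ->
    connected_by B -> acyclic A ->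
  A = B.
Proof.
move=> sBA invB /andP[_ /forallP conB] /acyclicP acA; apply/eqP.
rewrite eqEsubset sBA andbT; apply/subsetP=> e Ae; apply: contraT => nBe.
have /forallP/(_ (org e))/connectP[p0 pB0 last0] := conB (trm e).
have [p [pB up last_p]] : exists p, [/\ path (adj B) (trm e) p,
    uniq (trm e :: p) & last (trm e) p = org e].
  by case: (shortenP pB0) last0 => p pB up _ ->; exists p.
have [s [Bs ts os]] := lift_path pB.
have circ : circuit (e :: s).
  rewrite -{p}ts in pB up last_p os; rewrite /circuit /= rcons_path os.
  rewrite -andbA; apply/and3P; split.
  - by apply: nonbacktracking_path => //; apply: contra nBe => /(allP Bs)/invB; rewrite einvK.
  - have -> : trm (last e s) = org e by rewrite -last_p last_map.
    rewrite eqxx /=; case: (lastP s) Bs => [_|s' e']; first by rewrite eq_sym einv_neq.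
    rewrite all_rcons last_rcons => /andP[Be' _]; apply: contraNneq nBe => ->.
    exact: invB.
  - by rewrite -last_p -rcons_uniq -lastI.
have := acA (e :: s); rewrite circ /= Ae => /(_ _)/negP[] //.
by apply: sub_all Bs => e' /(subsetP sBA).
Qed.

(** An arborescence amounts to a root and a spanning tree. Given both, a search inside the tree
    yields an arborescence whose support, being connected, is the whole tree. *)
Lemma card_arborescences : #|arborescences X| = #|V| * #|spanning_trees X|.
Proof.
rewrite -(card_in_imset (@support_inj X)).
pose roots := [set [set r] | r : V].
have <- : #|roots| = #|V| by rewrite card_imset //; apply: set1_inj.
rewrite -cardsX; congr #|pred_of_set _|; apply/setP=> -[S A].
rewrite inE; apply/imsetP/andP=> /= [[f Af [-> ->]] | [/imsetP[r _ ->]]].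
  rewrite inE support_tree //; split=> //.
  by have /arborescenceP[r [_ _ ->]] := Af; apply: imset_f.
rewrite inE => /and3P[/forall_inP invA conA acA].
have [f Af [fr sfA]] := arborescence_exists r conA.
exists f => //; congr (_, _) => //; apply: connected_sub_acyclic => //.
- apply/subsetP=> e; rewrite inE => /orP[/(subsetP sfA) // | ].
  by move=> /(subsetP sfA)/invA; rewrite einvK.
- by move=> e; rewrite !inE einvK orbC.
- exact: support_connected.
Qed.

Lemma spanning_trees_gt0 : connected X -> 0 < #|spanning_trees X|.
Proof.
move=> conX; have /andP[/card_gt0P[r _] _] := conX.
have [f /support_tree Tf _] := arborescence_exists r conX.
by apply/card_gt0P; exists (support f); rewrite inE.
Qed.

Local Open Scope ring_scope.

Lemma wlap_coef (R : comNzRingType) i :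
  (fdet (wlap X ('X : {poly R}) (fun=> 1)))`_i
    = #|[set f : {ffun V -> option E} | [&& [forall v, admissible v (f v)],
                                        halting f & #|stops f| == i]]|%:R.
Proof.
rewrite fdet_wlap coef_sum; under eq_bigr do rewrite coefXn eq_sym.
rewrite -natr_sum; congr _%:R; rewrite -sum1_card big_mkcond [RHS]big_mkcond.
apply: eq_bigr => f _; rewrite inE andbA.
by case: (_ && halting f) => //=; case: eqP.
Qed.

(** The coefficient of ['X] replaces the usual cofactor; the factor [#|V|] counts the possible roots
    of a tree. *)
Theorem matrix_tree (R : comNzRingType) :
  (fdet (wlap X ('X : {poly R}) (fun=> 1)))`_1 = (#|V| * #|spanning_trees X|)%:R.
Proof. by rewrite wlap_coef -card_arborescences. Qed.

Lemma wlap_coef0 (R : comNzRingType) : (0 < #|V|)%N ->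
  (fdet (wlap X ('X : {poly R}) (fun=> 1)))`_0 = 0.
Proof.
case/card_gt0P=> v _; rewrite wlap_coef (_ : [set _ | _] = set0) ?cards0 //.
apply/setP=> f; rewrite !inE; apply/and3P=> -[_ hf /eqP/cards0_eq f0].
suff : v \in set0 by rewrite inE.
move: v; apply: (halting_ind hf) => [v fv | e _]; last by rewrite inE.
by rewrite -f0 inE fv.
Qed.
End TreeCount.

Local Open Scope ring_scope.

(** * Laplacians of covers *)

(* [Z] is the cover of [X] with constant fibre [I] in which the lift of [e]
   starting on sheet [i] ends on sheet [act e i]. *)
Definition sheeted (Z X : sgraph) (q : ghom Z X) (I : finType)
    (act : dedge X -> I -> I) : Prop :=
  exists (hV : vertex X * I -> vertex Z) (hE : dedge X * I -> dedge Z),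
    [/\ bijective hV, bijective hE, forall x, Defs.hV q (hV x) = x.1,
        forall y, Defs.hE q (hE y) = y.1 &
        forall e i, org (hE (e, i)) = hV (org e, i) /\
                    trm (hE (e, i)) = hV (trm e, act e i)].

Definition sheet_mx (R : comNzRingType) (I : finType) m (k : 'I_m -> I)
    (t : I -> I) : 'M[R]_m := \matrix_(i, j) (t (k i) == k j)%:R.

Section Sheeted.
Variables (Z X : sgraph) (q : ghom Z X) (I : finType) (act : dedge X -> I -> I).
Hypothesis Zq : sheeted q act.

Lemma card_sheeted : #|vertex Z| = (#|vertex X| * #|I|)%N.
Proof.
by have [hV [hE [bV _ _ _ _]]] := Zq; rewrite -(bij_eq_card bV) card_prod.
Qed.

Variables (R : comNzRingType) (u : R) (c : dedge X -> R).
Variables (m : nat) (k : 'I_m -> I) (S S' : 'M[R]_m).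
Hypotheses (bij_k : bijective k) (SS' : S *m S' = 1%:M).
Hypothesis trigS : forall e, is_trig_mx (S *m sheet_mx R k (act e) *m S').

(** Sorted by sheets, the Laplacian of [Z] is a matrix over [X] whose entries are combinations of
    the sheet matrices. A common triangularization [S] splits it into one twisted Laplacian of [X]
    for each diagonal position. *)
Lemma fdet_sheeted :
  fdet (wlap Z u (fun e => c (Defs.hE q e)))
  = \prod_i fdet (wlap X u (fun e => c e * (S *m sheet_mx R k (act e) *m S') i i)).
Proof.
have [hV [hE [bV bE qV qE hP]]] := Zq.
have bk : bijective (fun x : vertex X * 'I_m => (x.1, k x.2)).
  by have [k' kK k'K] := bij_k; exists (fun x => (x.1, k' x.2)) => -[x i] /=;
    rewrite ?kK ?k'K.
rewrite -(fdet_reindex _ bV) -(fdet_reindex _ bk) /=.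
pose A v w : 'M[R]_m := ((u + #|star v|%:R) *+ (v == w))%:M
  - \sum_(e | (org e == v) && (trm e == w)) c e *: sheet_mx R k (act e).
have trA v w : S *m A v w *m S' = ((u + #|star v|%:R) *+ (v == w))%:M
    - \sum_(e | (org e == v) && (trm e == w)) c e *: (S *m sheet_mx R k (act e) *m S').
  rewrite mulmxBr mulmxBl mul_mx_scalar -scalemxAl SS' scalemx1; congr (_ - _).
  rewrite mulmx_sumr mulmx_suml; apply: eq_bigr => e _.
  by rewrite -scalemxAr -scalemxAl.
transitivity (fdet (fun x y : vertex X * 'I_m => A x.1 y.1 x.2 y.2)).
  apply: eq_fdet => -[v i] [w j] /=; rewrite /wlap !mxE (bij_eq bV) xpair_eqE.
  rewrite (bij_eq bij_k) -mulrnA mulnb; congr (_ *+ _ - _).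
    congr (_ + _%:R); have inj1 : injective (fun e => hE (e, k i)).
      by move=> e e' /(bij_inj bE)[].
    rewrite -(card_imset _ inj1); apply: eq_card => e'; rewrite inE.
    apply/eqP/imsetP=> [|[e]].
      have [g hK gK] := bE; rewrite -[e']gK; case: (g e') => e i'.
      by rewrite (hP _ _).1 => /(bij_inj bV)[<- <-]; exists e; rewrite ?inE.
    by rewrite inE => /eqP <- ->; rewrite (hP _ _).1.
  rewrite summxE (reindex hE (onW_bij _ bE)) /=.
  rewrite (eq_bigl (fun y => (org y.1 == v) && (y.2 == k i) &&
      ((trm y.1 == w) && (act y.1 (k i) == k j)))) => [|[e i']]; last first.
    rewrite (hP _ _).1 (hP _ _).2 !(bij_eq bV) !xpair_eqE /=.
    by case: eqP => //= _; case: eqP => [->|].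
  transitivity (\sum_(e | (org e == v) && (trm e == w)) \sum_(i' | i' == k i)
      c e * (act e (k i) == k j)%:R).
    rewrite pair_big_dep /= [RHS]big_mkcond [LHS]big_mkcond.
    apply: eq_bigr => -[e i'] _ /=; rewrite qE /=.
    by do !case: eqP => //= _; rewrite ?mulr1 ?mulr0.
  by apply: eq_bigr => e _; rewrite big_pred1_eq !mxE.
rewrite (fdet_block SS') => [|v w]; last first.
  rewrite trA; apply/is_trig_mxP => i j ltij; rewrite !mxE summxE.
  rewrite -val_eqE (ltn_eqF ltij) sub0r big1 ?oppr0 // => e _.
  by rewrite mxE (is_trig_mxP (trigS e)) // mulr0.
apply: eq_bigr => i _; apply: eq_fdet => v w.
rewrite trA /wlap !mxE eqxx mulr1n summxE; congr (_ - _).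
by apply: eq_bigr => e _; rewrite mxE.
Qed.
End Sheeted.

(** The shift is a natural number, reduced only here modulo the number of sheets, so that the same
    voltages serve two levels of a tower. *)
Definition rotate N (a : nat) (i : 'I_N.+1) : 'I_N.+1 := inZp (i + a).

Section Fourier.
Variables (Z X : sgraph) (q : ghom Z X) (N : nat) (a : dedge X -> nat).
Hypothesis Zq : sheeted q (fun e => @rotate N (a e)).
Variables (F : fieldType) (z : F).
Hypothesis prim_z : N.+1.-primitive_root z.

(** The Vandermonde matrix of the powers of [z] diagonalizes all rotations at once; rotation by
    [a e] has eigenvalue [(z ^+ k) ^+ a e] on its column [k]. *)
Lemma fdet_cyclic :
  fdet (wlap Z 'X (fun=> 1))
    = \prod_(k < N.+1) fdet (wlap X 'X (fun e => ((z ^+ k) ^+ a e)%:P)).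
Proof.
pose V : 'M[F]_N.+1 := Vandermonde N.+1 (\row_k z ^+ k).
have uV : V \in unitmx.
  rewrite unitmxE det_Vandermonde unitfE prodf_seq_neq0.
  apply/allP=> i _; apply/implyP=> _; rewrite prodf_seq_neq0.
  apply/allP=> j _; apply/implyP=> lt_ij; rewrite !mxE subr_eq0.
  rewrite (eq_prim_root_expr prim_z) !modn_small // eq_sym.
  by rewrite (ltn_eqF lt_ij).
pose S := map_mx polyC (invmx V); pose S' := map_mx polyC V.
have SS' : S *m S' = 1%:M by rewrite -map_mxM mulVmx // map_mx1.
have diagS e : S *m sheet_mx {poly F} id (rotate (a e)) *m S'
    = diag_mx (\row_k ((z ^+ k) ^+ a e)%:P).
  rewrite -mulmxA; set D := diag_mx _.
  suff -> : sheet_mx {poly F} id (rotate (a e)) *m S' = S' *m D.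
    by rewrite mulmxA SS' mul1mx.
  apply/matrixP=> i k; rewrite mul_mx_diag !mxE (bigD1 (rotate (a e) i)) //=.
  rewrite mxE eqxx mul1r big1 ?addr0 => [|j /negPf ne]; last first.
    by rewrite mxE eq_sym ne mul0r.
  rewrite !mxE -polyCM -!exprM -exprD; congr _%:P.
  apply/eqP; rewrite (eq_prim_root_expr prim_z) -mulnDr.
  by rewrite /= modnMmr.
have bij_id : bijective (@id 'I_N.+1) by exists id.
rewrite (fdet_sheeted Zq 'X (fun=> 1) bij_id SS') => [|e]; last first.
  by rewrite diagS diag_mx_is_trig.
apply: eq_bigr => k _; apply: eq_fdet => v w; rewrite /wlap; congr (_ - _).
by apply: eq_bigr => e _; rewrite diagS !mxE eqxx mul1r.
Qed.
End Fourier.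

(** A polynomial rather than a Laurent polynomial: for a cyclic cover [a e] and [a (einv e)] cancel
    only modulo the number of sheets, and only the values at the corresponding roots of unity
    matter. *)
Definition voltage_det (X : sgraph) (a : dedge X -> nat) : {poly int} :=
  fdet (wlap X 0 (fun e => 'X^(a e))).

Lemma voltage_det_eval (X : sgraph) (a : dedge X -> nat) (z : algC) :
  (fdet (wlap X 'X (fun e => (z ^+ a e)%:P)))`_0
    = (map_poly intr (voltage_det a)).[z].
Proof.
rewrite -horner_coef0 -[_.[0]]/(horner_eval 0 _) -[_.[z]]/(horner_eval z _).
rewrite /voltage_det !fdet_map; apply: eq_fdet => v w; rewrite /wlap.
rewrite !(rmorphB, rmorphMn, rmorphD, rmorph_sum, raddf0, rmorph_nat) /=.
rewrite /horner_eval hornerX; congr (_ - _).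
  by rewrite rmorph1 !hornerC.
by apply: eq_bigr => e _; rewrite hornerC map_polyXn hornerXn.
Qed.

Lemma coef1_mul_coef0 (R : comNzRingType) (p r : {poly R}) :
  p`_0 = 0 -> (p * r)`_1 = p`_1 * r`_0.
Proof. by move=> p0; rewrite coefM !big_ord_recl big_ord0 p0 /= mul0r add0r addr0. Qed.

Lemma big_ord_dvd (R : Type) (idx : R) (op : Monoid.com_law idx) (l N0 N1 : nat)
    (F : nat -> R) : N1.+1 = (l * N0.+1)%N ->
  \big[op/idx]_(k < N1.+1 | (l %| k)%N) F k
    = \big[op/idx]_(k < N0.+1) F (l * k)%N.
Proof.
move=> def_N; have l_gt0 : (0 < l)%N by case: (l) def_N.
have lt_kl (k : 'I_N0.+1) : (l * k < N1.+1)%N by rewrite def_N ltn_pmul2l.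
rewrite (reindex_omap (fun k => Ordinal (lt_kl k))
           (fun k : 'I_N1.+1 => Some (inord (k %/ l)))) /=.
  by apply: eq_bigl => k; rewrite dvdn_mulr //= mulKn // inord_val eqxx.
move=> k l_k; congr Some; apply: val_inj => /=; rewrite inordK; last first.
  by rewrite ltn_divLR // mulnC -def_N.
by rewrite mulnC divnK.
Qed.

(** The characters with l dividing k are those of [Z0] and together give its Laplacian determinant.
    Its constant coefficient vanishes, so comparing coefficients of ['X] takes the other factors at
    ['X] = 0. *)
Lemma card_spanning_trees_step (X Z0 Z1 : sgraph) (q0 : ghom Z0 X)
    (q1 : ghom Z1 X) (a : dedge X -> nat) (l N0 N1 : nat) (z : algC) :
    N1.+1 = (l * N0.+1)%N -> N1.+1.-primitive_root z -> (0 < #|vertex X|)%N ->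
    sheeted q0 (fun e => @rotate N0 (a e)) ->
    sheeted q1 (fun e => @rotate N1 (a e)) ->
  (l * #|spanning_trees Z1|)%:R
    = #|spanning_trees Z0|%:R
      * \prod_(k < N1.+1 | ~~ (l %| k)%N) (map_poly intr (voltage_det a)).[z ^+ k].
Proof.
move=> def_N prim_z X_gt0 Zq0 Zq1.
have l_gt0 : (0 < l)%N by case: (l) def_N.
have prim_zl : N0.+1.-primitive_root (z ^+ l).
  by have := exp_prim_root prim_z l; rewrite def_N gcdnMr mulKn.
have := fdet_cyclic Zq1 prim_z; rewrite (bigID (fun k : 'I__ => (l %| k)%N)) /=.
rewrite (_ : \prod_(k < N1.+1 | (l %| k)%N) _ = fdet (wlap Z0 'X (fun=> 1))).
  2: rewrite (fdet_cyclic Zq0 prim_zl).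
  2: rewrite (big_ord_dvd _ (fun k => fdet (wlap X 'X (fun e => ((z ^+ k) ^+ a e)%:P))) def_N).
  2: by apply: eq_bigr => k _; rewrite exprM.
move/(congr1 (fun p : {poly algC} => p`_1)); rewrite coef1_mul_coef0; last first.
  by rewrite wlap_coef0 // (card_sheeted Zq0) card_ord muln_gt0 X_gt0.
rewrite !matrix_tree (card_sheeted Zq0) (card_sheeted Zq1) !card_ord def_N.
rewrite -horner_coef0 horner_prod.
under [X in _ = _ * X -> _]eq_bigr do rewrite horner_coef0 voltage_det_eval.
set P := \prod_(k < _ | _) _.
rewrite (_ : (_ * (l * _) * _)%N
  = (#|vertex X| * N0.+1 * (l * #|spanning_trees Z1|))%N); last first.
  by rewrite -!mulnA; congr (_ * _)%N; rewrite mulnCA.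
rewrite natrM [X in _ = X * _]natrM -[RHS]mulrA => /mulfI; apply.
by rewrite pnatr_eq0 -lt0n muln_gt0 X_gt0.
Qed.

(** * Valuations of norms from prime power cyclotomic fields *)

Lemma lift_Fp_poly (l : nat) (p : {poly 'F_l}) :
  exists P : {poly int}, map_poly intr P = p.
Proof.
exists (map_poly (fun x : 'F_l => (x : nat)%:Z) p); apply/polyP=> i.
by rewrite coef_map coef_map_id0 //= -pmulrn natr_Zp.
Qed.

Lemma Fp_poly_eq0 (l : nat) (P : {poly int}) :
  prime l -> map_poly intr P = 0 :> {poly 'F_l} -> exists Q, P = l%:R *: Q.
Proof.
move=> pr_l P0; exists (\poly_(i < size P) (P`_i %/ l)%Z); apply/polyP=> i.
rewrite coefZ coef_poly; case: ltnP => [_ | /(nth_default 0) ->]; last by rewrite mulr0.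
rewrite mulrC natz; apply/esym/divzK; rewrite (dvdz_pcharf (pchar_Fp pr_l)).
by move/polyP/(_ i): P0; rewrite coef_map coef0 /= => ->.
Qed.

Lemma Aint_horner (p : {poly int}) x :
  x \in Aint -> (map_poly intr p).[x] \in Aint.
Proof.
move=> Ax; rewrite horner_coef rpred_sum // => i _.
by rewrite coef_map rpredM ?rpredX ?Aint_int.
Qed.

(** Applied with [y] = 1 - z^k, [a] = l and d + 1 + m = [prim_count], to pull y^d out of f(z^k). *)
Lemma twisted_factor (F : fieldType) (a b c s y Q : F) d m : y != 0 ->
  a * Q + (b * - y + c) * (s * y ^+ d)
    = y ^+ d * (s * c + y * (s * - b + a / y ^+ d.+1 / y ^+ m * y ^+ m * Q)).
Proof.
move=> nz; rewrite divfK ?expf_neq0 // exprS.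
have : y ^+ d != 0 by rewrite expf_neq0.
by move: (y ^+ d) => t nt; field; rewrite nz nt.
Qed.

Lemma sub_mul_factor (F : fieldType) (c y v w p r : F) :
  ((c + v * w) * p - c * r) / y = v / y * (w * p) + c * ((p - r) / y).
Proof. by ring. Qed.

Section PrimePowerCyclotomic.
Variables (l n : nat) (z : algC).
Hypothesis pr_l : prime l.
Local Notation N0 := (l ^ n).-1.
Local Notation N1 := (l ^ n.+1).-1.
Hypothesis prim_z : N1.+1.-primitive_root z.

Let l_gt0 : (0 < l)%N. Proof. exact: prime_gt0. Qed.
Let defN0 : N0.+1 = (l ^ n)%N. Proof. by rewrite prednK ?expn_gt0 ?l_gt0. Qed.
Let defN1 : N1.+1 = (l ^ n.+1)%N. Proof. by rewrite prednK ?expn_gt0 ?l_gt0. Qed.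
Let defN : N1.+1 = (l * N0.+1)%N. Proof. by rewrite defN1 defN0 expnS. Qed.

Local Notation good k := (~~ (l %| k)%N).

Lemma prim_root_exp : N0.+1.-primitive_root (z ^+ l).
Proof. by have := exp_prim_root prim_z l; rewrite defN gcdnMr mulKn. Qed.

(** This is the value at 1 of the cyclotomic polynomial, the quotient of X^(l^(n+1)) - 1 by X^(l^n)
    - 1, which is a sum of l powers of X. *)
Lemma prod_one_sub_prim_root : \prod_(k < N1.+1 | good k) (1 - z ^+ k) = l%:R.
Proof.
have factor m (w : algC) : m.+1.-primitive_root w ->
    \prod_(k < m.+1) ('X - (w ^+ k)%:P) = 'X^(m.+1) - 1.
  by move/factor_Xn_sub_1 <-; rewrite big_mkord.
have := factor _ _ prim_z; rewrite (bigID (fun k : 'I__ => (l %| k)%N)) /=.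
have -> : \prod_(k < N1.+1 | (l %| k)%N) ('X - (z ^+ k)%:P) = 'X^(N0.+1) - 1.
  rewrite -(factor _ _ prim_root_exp) (big_ord_dvd _ (fun k => 'X - (z ^+ k)%:P) defN).
  by apply: eq_bigr => k _; rewrite exprM.
have -> : 'X^(N1.+1) - 1 = ('X^(N0.+1) - 1) * \sum_(i < l) 'X^(N0.+1) ^+ i :> {poly algC}.
  by rewrite -subrX1 -exprM mulnC -defN.
have nz : 'X^(N0.+1) - 1 != 0 :> {poly algC} by rewrite -size_poly_gt0 size_XnsubC.
move/(mulfI nz)/(congr1 (horner^~ 1)).
rewrite horner_prod; under eq_bigr do rewrite hornerXsubC.
move=> ->.
rewrite horner_sum -[in RHS](card_ord l) -sumr_const.
by apply: eq_bigr => i _; rewrite -exprM hornerXn expr1n.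
Qed.

Lemma one_sub_prim_root_neq0 k : good k -> 1 - z ^+ k != 0.
Proof.
move=> k_l; rewrite subr_eq0 eq_sym -(prim_order_dvd prim_z) defN.
by apply: contra k_l => /(dvdn_trans _) -> //; apply: dvdn_mulr.
Qed.

(** Each of the two roots of unity is a power of the other, so the ratio is a geometric sum. By
    symmetry it is a unit. *)
Lemma Aint_one_sub_ratio k k' : good k -> good k' ->
  (1 - z ^+ k') / (1 - z ^+ k) \in Aint.
Proof.
move=> kl k'l; have cop : coprime k N1.+1.
  by rewrite defN1 coprimeXr // coprime_sym prime_coprime.
have [m zk'] : exists m, z ^+ k' = (z ^+ k) ^+ m.
  have k_gt0 : (0 < k)%N by case: (k) kl; rewrite ?dvdn0.
  case: (egcdnP N1.+1 k_gt0) => u v; rewrite (eqP cop) => def_u _.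
  exists (u * k')%N; rewrite -exprM mulnA [(k * u)%N]mulnC def_u.
  rewrite mulnDl mul1n exprD -mulnA mulnCA exprM (prim_expr_order prim_z).
  by rewrite expr1n mul1r.
rewrite zk' -opprB -[1 - z ^+ k]opprB invrN mulrNN subrX1 mulrAC divff ?mul1r.
  by rewrite rpred_sum // => i _; rewrite !rpredX // (Aint_prim_root prim_z).
by rewrite -oppr_eq0 opprB one_sub_prim_root_neq0.
Qed.

(** Euler's phi(l^(n+1)), attached to the step from level n to level n + 1. *)
Definition prim_count := #|[pred k : 'I_N1.+1 | good k]|.

Lemma prim_countE : (prim_count + l ^ n = l ^ n.+1)%N.
Proof.
rewrite -defN1 -[RHS]card_ord -sum1_card [RHS](bigID (fun k : 'I__ => (l %| k)%N)) /=.
rewrite (big_ord_dvd _ (fun=> 1%N) defN) sum1_card card_ord defN0 addnC.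
by rewrite /prim_count sum1_card.
Qed.

(** Total ramification of l, stated by integrality of both quotients. *)
Lemma prime_over_power k : good k ->
  l%:R / (1 - z ^+ k) ^+ prim_count \in Aint
  /\ (1 - z ^+ k) ^+ prim_count / l%:R \in Aint.
Proof.
move=> kl; rewrite -prod_one_sub_prim_root -prodr_const -!prodf_div.
by split; apply: rpred_prod => i il; apply: Aint_one_sub_ratio.
Qed.

Section Norm.
Variables (f : {poly int}) (k0 k1 : nat).
Local Notation fbar := (map_poly intr f : {poly 'F_l}).
Hypotheses (k0_gt0 : (0 < k0)%N) (k1_gt0 : (0 < k1)%N).
Hypothesis k01 : (l * k1)%:R
  = k0%:R * \prod_(k < N1.+1 | good k) (map_poly intr f).[z ^+ k] :> algC.

(** By [k01], [Q] is a quotient of natural numbers; being also an algebraic integer, it is a natural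
    number. *)
Lemma norm_factor d (Q : algC) :
    \prod_(k < N1.+1 | good k) (map_poly intr f).[z ^+ k] = l%:R ^+ d * Q ->
    Q \in Aint ->
  exists2 m, Q = m%:R & (logn l k1 + 1 = logn l k0 + d + logn l m)%N /\ (0 < m)%N.
Proof.
move=> def_P AQ; have nz (i : nat) : (0 < i)%N -> i%:R != 0 :> algC.
  by rewrite pnatr_eq0 lt0n.
have defQ : Q = (l * k1)%:R / (k0 * l ^ d)%:R.
  rewrite k01 def_P natrM natrX mulrA mulrAC divff ?mul1r //.
  by rewrite mulf_neq0 ?expf_neq0 ?nz.
have : Q \in Num.nat.
  rewrite natrEint Cint_rat_Aint //= defQ ?rpred_div ?rpred_nat //.
  by rewrite divr_ge0 ?ler0n.
case/natrP=> m Qm; exists m => //.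
have Em : (l * k1 = k0 * l ^ d * m)%N.
  apply/eqP; rewrite -(eqr_nat algC) [X in _ == X]natrM -Qm defQ mulrC divfK //.
  by rewrite nz // muln_gt0 k0_gt0 expn_gt0 l_gt0.
have m_gt0 : (0 < m)%N.
  by have := muln_gt0 l k1; rewrite l_gt0 k1_gt0 Em !muln_gt0 => /andP[].
split=> //; have /(congr1 (logn l)) := Em.
rewrite !lognM ?muln_gt0 ?k0_gt0 ?expn_gt0 ?l_gt0 // pfactorK //.
by rewrite lognE pr_l dvdnn divnn l_gt0 logn1 addnC.
Qed.

Let Az k : z ^+ k \in Aint.
Proof. by rewrite rpredX // (Aint_prim_root prim_z). Qed.

(** Write f = h (X - 1)^phi + l q. At z^k both terms are divisible by l, so each of the phi factors
    contributes at least one l. *)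
Lemma logn_step_ge : ('X - 1%:P) ^+ prim_count %| fbar ->
  (logn l k0 + prim_count <= logn l k1 + 1)%N.
Proof.
case/dvdpP=> hbar fh; have [h def_h] := lift_Fp_poly hbar.
have [|q def_q] := @Fp_poly_eq0 l (f - h * ('X - 1%:P) ^+ prim_count) pr_l.
  rewrite rmorphB rmorphM rmorphXn rmorphB /= map_polyX map_polyC /= fh def_h.
  by rewrite subrr.
pose s k : algC := (map_poly intr h).[z ^+ k] * ((-1) ^+ prim_count *
   ((1 - z ^+ k) ^+ prim_count / l%:R)) + (map_poly intr q).[z ^+ k].
have [] := @norm_factor prim_count (\prod_(k < N1.+1 | good k) s k).
- rewrite -prodr_const -big_split; apply: eq_bigr => k kl.
  move/eqP: def_q; rewrite subr_eq => /eqP ->.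
  rewrite rmorphD rmorphM rmorphXn rmorphB /= map_polyX map_polyC /=.
  rewrite linearZ /= hornerD hornerM horner_exp hornerXsubC hornerZ /s.
  rewrite mulrDr [l%:R * _]mulrCA addrC rmorph_nat; congr (_ * _ + _).
  rewrite mulrCA [l%:R * _]mulrC divfK ?pnatr_eq0 -?lt0n //.
  by rewrite -exprMn mulN1r opprB.
- apply: rpred_prod => k kl; rewrite rpredD ?Aint_horner // rpredM ?Aint_horner //.
  by rewrite rpredM ?(prime_over_power kl).2 // rpredX // rpredN rpred1.
by move=> m _ [-> _]; apply: leq_addr.
Qed.

(** Write f = h (X - 1)^d + l q with c = h(1) prime to l. Since d < phi, l is divisible by y^(d+1)
    for y = 1 - z^k, so f(z^k) is y^d times a number congruent to c or -c modulo y. The powers y^d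
    multiply to l^d and the cofactor is prime to l. *)
Lemma logn_step_eq : fbar != 0 -> (mup 1 fbar < prim_count)%N ->
  (logn l k1 + 1 = logn l k0 + mup 1 fbar)%N.
Proof.
move=> f0; set d := mup 1 fbar => lt_d.
have /dvdpP[hbar fh] : ('X - 1%:P) ^+ d %| fbar by rewrite -mup_geq.
have hbar1 : hbar.[1] != 0.
  apply/negP=> /factor_theorem[r def_r].
  have : ('X - 1%:P) ^+ d.+1 %| fbar by rewrite fh def_r -mulrA -exprS dvdp_mull.
  by rewrite -mup_geq // ltnn.
have [h def_h] := lift_Fp_poly hbar; pose c := h.[1].
have c_l : ~~ (l %| c)%Z.
  rewrite (dvdz_pcharf (pchar_Fp pr_l)); apply: contra hbar1.
  by rewrite /c -def_h -[1]/(1%:~R : 'F_l) horner_map.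
have [|q def_q] := @Fp_poly_eq0 l (f - h * ('X - 1%:P) ^+ d) pr_l.
  rewrite rmorphB rmorphM rmorphXn rmorphB /= map_polyX map_polyC /= fh def_h.
  by rewrite subrr.
have /factor_theorem[h' def_h'] : root (h - c%:P) 1.
  by rewrite /root hornerD hornerN hornerC subrr.
pose w k : algC := (-1) ^+ d * - (map_poly intr h').[z ^+ k]
  + l%:R / (1 - z ^+ k) ^+ prim_count * (1 - z ^+ k) ^+ (prim_count - d.+1)
    * (map_poly intr q).[z ^+ k].
have A1 : (-1) ^+ d \in Aint by rewrite rpredX // rpredN rpred1.
have A1z k : 1 - z ^+ k \in Aint by rewrite rpredB ?rpred1.
have Aw k : good k -> w k \in Aint.
  move=> kl; apply: rpredD; first by rewrite rpredM // rpredN Aint_horner.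
  apply: rpredM; last exact: Aint_horner.
  by apply: rpredM (prime_over_power kl).1 _; apply: rpredX.
have fz k : good k -> (map_poly intr f).[z ^+ k]
    = (1 - z ^+ k) ^+ d * ((-1) ^+ d * c%:~R + (1 - z ^+ k) * w k).
  move=> kl; move/eqP: def_q; rewrite subr_eq => /eqP ->.
  move/eqP: def_h'; rewrite subr_eq => /eqP ->.
  have : (map_poly intr ('X - 1%:P : {poly int})).[z ^+ k] = - (1 - z ^+ k).
    by rewrite rmorphB /= map_polyX map_polyC hornerXsubC /= opprB.
  move: ('X - 1%:P) => E EX.
  rewrite !(rmorphD, rmorphM, rmorphXn) /= linearZ /= map_polyC /=.
  rewrite !(hornerD, hornerM) horner_exp hornerZ hornerC EX /w.
  have [nz lX] := (one_sub_prim_root_neq0 kl, subnKC lt_d).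
  rewrite -[in X in _ / X]lX exprD invfM !mulrA.
  set y := 1 - z ^+ k in nz *; rewrite rmorph_nat [(- y) ^+ d]exprNn.
  set m := (prim_count - _)%N; set H := (map_poly _ h').[_]; set Q := _.[_].
  exact: twisted_factor.
pose W (k : nat) : algC := (-1) ^+ d * c%:~R + (1 - z ^+ k) * w k.
have AW k : good k -> W k \in Aint.
  by move=> kl; rewrite rpredD // rpredM ?Aw ?Aint_int.
have [||m Qm [-> m_gt0]] := @norm_factor d (\prod_(k < N1.+1 | good k) W k).
- rewrite -prod_one_sub_prim_root -prodrXl -big_split.
  by apply: eq_bigr => k /fz.
- by apply: rpred_prod => k /AW.
suff l_m : ~~ (l %| m)%N by rewrite (lognE l m) (negPf l_m) !andbF addn0.
(* If l divided [m], then [y] would divide [m] and also [m] minus [c' ^+ prim_count]. It would thus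
   divide two coprime integers, l and [c' ^+ prim_count], and be a unit. *)
apply/negP=> /dvdnP[m' def_m]; pose y : algC := 1 - z ^+ 1.
have l1 : good 1%N by rewrite dvdn1 neq_ltn prime_gt1 ?orbT.
pose c' : int := (-1) ^+ d * c.
have cop : coprimez l (c' ^+ prim_count).
  by rewrite coprimezXr // coprimezE abszMsign /= prime_coprime.
have Ay : l%:R / y \in Aint.
  have := rpredM (prime_over_power l1).1 (rpredX prim_count.-1 (A1z 1%N)).
  rewrite -/y; case: prim_count lt_d => // k _; rewrite exprS invfM !mulrA.
  by rewrite divfK // expf_neq0 // one_sub_prim_root_neq0.
have : (\prod_(k < N1.+1 | good k) W k
        - \prod_(k < N1.+1 | good k) c'%:~R) / y \in Aint.
  suff [] : (\prod_(k < N1.+1 | good k) W k \in Aint) /\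
   ((\prod_(k < N1.+1 | good k) W k - \prod_(k < N1.+1 | good k) c'%:~R) / y \in Aint).
    by [].
  apply: (big_rec2 (fun p r : algC => p \in Aint /\ (p - r) / y \in Aint)).
    by rewrite subrr mul0r rpred1 rpred0.
  move=> k p r kl [Ap Apr]; split; first by rewrite rpredM ?AW.
  have -> : (W k * p - c'%:~R * r) / y
    = (1 - z ^+ k) / y * (w k * p) + c'%:~R * ((p - r) / y).
    by rewrite /W /c' rmorphM rmorphXn rmorphN rmorph1; apply: sub_mul_factor.
  apply: rpredD; last exact: rpredM (Aint_int _) Apr.
  exact: rpredM (Aint_one_sub_ratio l1 kl) (rpredM (Aw _ kl) Ap).
rewrite Qm def_m natrM mulrBl -mulrA => Am.
have Ac : (c' ^+ prim_count)%:~R / y \in Aint.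
  have := rpredB (rpredM (Aint_int m'%:Z) Ay) Am.
  by rewrite opprB addrC subrK prodr_const rmorphXn.
have A1y : 1 / y \in Aint.
  have [u [v uv]] := Bezoutz l (c' ^+ prim_count).
  have -> : 1 / y = u%:~R * (l%:R / y) + v%:~R * ((c' ^+ prim_count)%:~R / y).
    rewrite !mulrA -mulrDl -[l%:R]/(l%:Z%:~R) -!rmorphM -rmorphD uv.
    by rewrite (eqP cop).
  by apply: rpredD; apply: rpredM => //; apply: Aint_int.
(* All the 1 - z^k are associates of [y], so their product l would be a unit too. *)
have : 1 / l%:R \in Aint.
  rewrite -prod_one_sub_prim_root mul1r -prodfV; apply: rpred_prod => k kl.
  have -> : (1 - z ^+ k)^-1 = 1 / y * (y / (1 - z ^+ k)).
    by rewrite mulrA divfK ?mul1r // one_sub_prim_root_neq0.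
  by rewrite rpredM // Aint_one_sub_ratio.
move=> /(Cint_rat_Aint _); rewrite rpred_div ?rpred1 ?rpred_nat // => /(_ isT).
move/norm_intr_ge1; rewrite mul1r invr_eq0 pnatr_eq0 -lt0n l_gt0 => /(_ isT).
by rewrite normfV normr_nat invr_ge1 ?unitfE ?pnatr_eq0 -?lt0n ?ltr0n // lern1 leqNgt prime_gt1.
Qed.
End Norm.
End PrimePowerCyclotomic.

(** * Covers of prime power degree *)

(** An l-group acting on a nonzero space in characteristic l fixes a nonzero vector; the induction
    continues on the quotient. *)
Lemma pgroup_unitriangular (F : fieldType) (l : nat) (gT : finGroupType)
    (G : {group gT}) (n : nat) (rG : mx_representation F G n) :
    l \in [pchar F] -> (l.-group G)%g ->
  exists S S' : 'M[F]_n, S *m S' = 1%:M /\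
    {in G, forall x, is_trig_mx (S *m rG x *m S')
                     /\ forall i, (S *m rG x *m S') i i = 1}.
Proof.
move=> chF pG; elim: n rG => [|n IHn] rG.
  exists 1%:M, 1%:M; split=> [|x _]; first by rewrite mulmx1.
  by split=> [|[]//]; apply/is_trig_mxP=> -[].
have /rowV0Pn[v /rfix_mxP fix_v v0] : rfix_mx rG G != 0.
  exact: (rfix_pgroup_pchar chF rG _ pG (subxx _)).
(* [B] completes a multiple of [v] to a basis, so the conjugated matrices have first row [e0]. *)
pose B := row_ebase v; have uB : B \in unitmx := row_ebase_unit v.
pose e0 : 'rV[F]_(1 + n) := row_mx 1%:M 0.
have [c c0 vB] : exists2 c, c != 0 & v = c *: (e0 *m B).
  have rv : \rank v = 1%N by rewrite rank_rV v0.
  pose C := col_ebase v; have uC : C \in unitmx := col_ebase_unit v.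
  exists (C 0 0).
    by apply: contraTneq uC => C0; rewrite unitmxE det_mx11 C0 unitr0.
  rewrite -[LHS]mulmx_ebase rv -/B [col_ebase v]mx11_scalar -/C scalemxAl -mul_scalar_mx.
  by congr (_ *m _ *m _); apply: pid_mx_row.
have e0_fix x : x \in G -> e0 *m (B *m rG x *m invmx B) = e0.
  move=> Gx; have := fix_v x Gx; rewrite vB -scalemxAl => /(scalerI c0).
  by rewrite !mulmxA => ->; rewrite mulmxK.
pose M x : 'M_(1 + n) := B *m rG x *m invmx B.
have Mblock x : x \in G -> M x = block_mx 1%:M 0 (dlsubmx (M x)) (drsubmx (M x)).
  move=> /e0_fix Mx; have : row_mx 1%:M 0 *m block_mx (ulsubmx (M x)) (ursubmx (M x))
     (dlsubmx (M x)) (drsubmx (M x)) = row_mx 1%:M 0 by rewrite submxK.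
  rewrite mul_row_block !mul1mx !mul0mx !addr0 => /eq_row_mx[Mul Mur].
  by rewrite -[LHS]submxK Mul Mur.
have MM x y : x \in G -> y \in G -> M (x * y)%g = M x *m M y.
  move=> Gx Gy; rewrite /M repr_mxM // !mulmxA.
  by congr (_ *m _ *m _); rewrite mulmxKV.
have repM : mx_repr G (fun x => drsubmx (M x)).
  split=> [|x y Gx Gy].
    rewrite /M repr_mx1 mulmx1 mulmxV //; apply/matrixP=> i j.
    by rewrite !mxE -!val_eqE /= eqn_add2l.
  rewrite MM // {1}(Mblock x Gx) {1}(Mblock y Gy) mulmx_block block_mxKdr.
  by rewrite mulmx0 add0r.
have [S [S' [SS' trS]]] := IHn (MxRepresentation repM).
pose T : 'M_(1 + n) := block_mx 1%:M 0 0 S.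
pose T' : 'M_(1 + n) := block_mx 1%:M 0 0 S'.
have TT' : T *m T' = 1%:M.
  rewrite mulmx_block SS' !mulmx0 !mul0mx !addr0 !add0r mulmx1.
  by rewrite -scalar_mx_block.
have conjT L D :
    T *m block_mx 1%:M 0 L D *m T' = block_mx 1%:M 0 (S *m L) (S *m D *m S').
  by rewrite !mulmx_block !(mulmx0, mul0mx, addr0, add0r, mulmx1).
have blockT L (D : 'M[F]_n) : is_trig_mx D ->
    is_trig_mx (block_mx (1%:M : 'M_1) 0 L D).
  by move=> tr; rewrite is_trig_block_mx // eqxx tr scalar_mx_is_trig.
have blockD L (D : 'M[F]_n) : (forall i, D i i = 1) ->
    forall i, block_mx (1%:M : 'M_1) 0 L D i i = 1.
  move=> diag i; rewrite -[i]splitK; case: (split i) => j /=.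
    by rewrite block_mxEul mxE eqxx.
  by rewrite block_mxEdr.
exists (T *m B), (invmx B *m T'); split=> [|x Gx].
  by rewrite mulmxA mulmxK.
have -> : T *m B *m rG x *m (invmx B *m T') = T *m M x *m T'.
  by rewrite /M !mulmxA.
rewrite (Mblock x Gx) conjT.
have [tr diag] := trS x Gx; split; [exact: blockT tr | exact: blockD diag].
Qed.

Section RegularSheets.
Variables (F : fieldType) (l : nat) (gT : finGroupType).
Hypotheses (chF : l \in [pchar F]) (pT : (l.-group [set: gT])%g).

Definition translation (g : gT) (x : gT) : gT := (x * g)%g.

Lemma translation_mx_repr :
  mx_repr [set: gT] (fun g => sheet_mx F (@enum_val gT predT) (translation g)).
Proof.
split=> [|g h _ _]; apply/matrixP=> i j; rewrite !mxE.
  by rewrite /translation mulg1 (inj_eq enum_val_inj).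
rewrite (bigD1 (enum_rank (enum_val i * g)%g)) //= !mxE enum_rankK eqxx mul1r.
rewrite big1 ?addr0 /translation ?mulgA // => k /negPf nk; rewrite !mxE.
by rewrite -(can_eq enum_rankK) enum_valK eq_sym nk mul0r.
Qed.

Lemma voltage_det_pcover (Y X : sgraph) (p : ghom Y X) (b : dedge X -> gT)
    (a : dedge X -> nat) :
    sheeted p (fun e => translation (b e)) ->
  map_poly intr (voltage_det (fun e => a (hE p e)))
    = map_poly intr (voltage_det a) ^+ #|gT| :> {poly F}.
Proof.
move=> Yp; have mapE (Z : sgraph) (a' : dedge Z -> nat) :
    map_poly intr (voltage_det a') = fdet (wlap Z 0 (fun e => 'X^(a' e))) :> {poly F}.
  rewrite /voltage_det fdet_map; apply: eq_fdet => v w; rewrite /wlap.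
  rewrite !(rmorphB, rmorphMn, rmorphD, rmorph_sum, raddf0, rmorph_nat) rmorph1 /=.
  by congr (_ - _); apply: eq_bigr => e _; rewrite map_polyXn.
have [S [S' [SS' trS]]] := pgroup_unitriangular (MxRepresentation translation_mx_repr) chF pT.
have SSp : map_mx polyC S *m map_mx polyC S' = 1%:M by rewrite -map_mxM SS' map_mx1.
have conj e : map_mx polyC S *m sheet_mx {poly F} (@enum_val gT predT) (translation (b e))
     *m map_mx polyC S' =
   map_mx polyC (S *m sheet_mx F (@enum_val gT predT) (translation (b e)) *m S').
  rewrite !map_mxM; congr (_ *m _ *m _); apply/matrixP=> i j; rewrite !mxE.
  by rewrite rmorph_nat.
rewrite !mapE (fdet_sheeted Yp 0 (fun e => 'X^(a e)) (@enum_val_bij gT) SSp) => [|e].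
  rewrite -[#|gT| in RHS]card_ord -prodr_const; apply: eq_bigr => i _.
  apply: eq_fdet => v w; congr (_ - _); apply: eq_bigr => e _.
  by rewrite conj mxE (trS (b e) _).2 ?inE // mulr1.
rewrite conj; apply/is_trig_mxP=> i j lt_ij; rewrite mxE.
by rewrite (is_trig_mxP (trS (b e) _).1) ?inE.
Qed.
End RegularSheets.

Local Open Scope nat_scope.

(** * Galois covers and towers *)

(** Agreement spreads along edges, since a cover is injective on stars. *)
Lemma cover_lift_unique (W Z X : sgraph) (q : ghom Z X) (F G : ghom W Z) w0 :
    is_cover q -> connected W ->
    (forall e, hE q (hE F e) = hE q (hE G e)) -> hV F w0 = hV G w0 ->
  hV F =1 hV G /\ hE F =1 hE G.
Proof.
move=> [_ covq] /andP[_ /forallP conW] qFG FG0.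
have FGe e : hV F (org e) = hV G (org e) -> hE F e = hE G e.
  move=> FGo; apply: (covq (hV F (org e))).1 (qFG e); rewrite inE hom_org //.
  by rewrite FGo.
have FGv w : hV F w = hV G w.
  have /forallP/(_ w)/connectP[p] := conW w0.
  elim: p w0 FG0 {conW} => [|w1 p IHp] w0 FG0 /=; first by move=> _ ->.
  move=> /andP[/exists_inP[e _ /andP[/eqP ew0 /eqP ew1]] pW].
  by apply: IHp pW; rewrite -ew1 -!hom_trm FGe // ew0.
by split=> // e; apply: FGe.
Qed.

Section CoverAut.
Variables (Y X : sgraph) (f : ghom Y X).

Lemma cover_autP s : s \in cover_aut f ->
  [/\ forall e, org (s.2 e) = s.1 (org e), forall e, trm (s.2 e) = s.1 (trm e),
      forall e, einv (s.2 e) = s.2 (einv e), forall w, hV f (s.1 w) = hV f w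
    & forall e, hE f (s.2 e) = hE f e].
Proof.
rewrite inE => /and3P[/forallP gs /forallP sV /forallP sE].
by split=> [e|e|e|w|e]; try exact/eqP; have /and3P[/eqP ? /eqP ? /eqP ?] := gs e.
Qed.

Lemma cover_aut_ghom s : s \in cover_aut f ->
  exists F : ghom Y Y, hV F = s.1 /\ hE F = s.2.
Proof.
by case/cover_autP=> so st si _ _; exists (GHom so st si).
Qed.

Lemma cover_aut_free s t w : is_cover f -> connected Y ->
  s \in cover_aut f -> t \in cover_aut f -> s.1 w = t.1 w -> s = t.
Proof.
move=> covf conY fs ft st; have [_ _ _ _ sE] := cover_autP fs.
have [_ _ _ _ tE] := cover_autP ft.
have [[F [FV FE]] [G [GV GE]]] := (cover_aut_ghom fs, cover_aut_ghom ft).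
have [|| eV eE] := @cover_lift_unique _ _ _ f F G w covf conY.
- by move=> e; rewrite FE GE sE tE.
- by rewrite FV GV.
rewrite [s]surjective_pairing [t]surjective_pairing; congr (_, _).
  by apply/permP=> x; rewrite -FV -GV eV.
by apply/permP=> x; rewrite -FE -GE eE.
Qed.

Lemma card_galois_fiber v : is_galois f -> #|fiber f v| = #|cover_aut f|.
Proof.
case=> covf conY trf; have [w wv] := covf.1 v.
have fw : w \in fiber f v by rewrite inE wv.
rewrite -(card_in_imset (f := fun s : {perm vertex Y} * {perm dedge Y} => s.1 w) (D := cover_aut f)).
  apply: eq_card => w'; apply/idP/imsetP => [fw' | [s fs ->]].
    by have [s fs <-] := trf v w w' fw fw'; exists s.
  by have [_ _ _ sV _] := cover_autP fs; rewrite inE sV wv.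
by move=> s t fs ft; apply: cover_aut_free.
Qed.

Lemma cover_section : is_cover f -> exists s, forall v, hV f (s v) = v.
Proof. by case=> /fin_all_exists. Qed.

Lemma cover_lift_edge e w : is_cover f -> hV f w = org e ->
  exists e', org e' = w /\ hE f e' = e.
Proof.
case=> _ covf fw; have /setP/(_ e) := (covf w).2; rewrite !inE fw eqxx.
by case/imsetP=> e'; rewrite inE => /eqP e'w ->; exists e'.
Qed.
End CoverAut.

Lemma expg_pair (aT bT : finGroupType) (x : aT * bT) n :
  ((x ^+ n).1 = x.1 ^+ n /\ (x ^+ n).2 = x.2 ^+ n)%g.
Proof. by elim: n => [|n [IH1 IH2]] //; rewrite !expgS /= IH1 IH2. Qed.

Section CyclicSheets.
Variables (Z X : sgraph) (q : ghom Z X) (N : nat).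
Variables (g : {perm vertex Z} * {perm dedge Z}) (s : vertex X -> vertex Z).
Variable a : dedge X -> nat.
Hypotheses (covq : is_cover q) (qg : g \in cover_aut q).
Hypothesis g_tr : forall w w', hV q w = hV q w' -> exists i, w' = (g ^+ i)%g.1 w.
Hypothesis card_q : forall v, #|fiber q v| = N.+1.
Hypothesis qs : forall v, hV q (s v) = v.
Hypothesis a_lift : forall e, exists e',
  [/\ hE q e' = e, org e' = s (org e) & trm e' = (g ^+ a e)%g.1 (s (trm e))].

Let gE i w : (g ^+ i)%g.1 w = iter i g.1 w.
Proof. by rewrite (expg_pair _ _).1 permX. Qed.

Let q_iter i w : hV q (iter i g.1 w) = hV q w.
Proof.
by rewrite -gE; have [_ _ _ -> _] := cover_autP (groupX i qg).
Qed.

Let card_orbit w : #|porbit g.1 w| = N.+1.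
Proof.
rewrite -(card_q (hV q w)); apply: eq_card => w'; rewrite inE.
apply/porbitP/eqP => [[i ->] | /esym/g_tr[i ->]]; first by rewrite permX q_iter.
by exists i; rewrite (expg_pair _ _).1.
Qed.

Let iter_mod i w : iter (i %% N.+1) g.1 w = iter i g.1 w.
Proof.
rewrite {2}(divn_eq i N.+1) addnC iterD; congr (iter _ _ _); symmetry.
elim: (i %/ _) => // k IHk; rewrite mulSn iterD IHk.
by rewrite -{1}(card_orbit w) iter_porbit.
Qed.

Let iter_inj w (i j : 'I_N.+1) : iter i g.1 w = iter j g.1 w -> i = j.
Proof.
move=> eq_ij; apply/val_inj/eqP => /=; have := uniq_traject_porbit g.1 w.
rewrite card_orbit => /(nth_uniq w) <-; rewrite ?size_traject //.
by rewrite !nth_traject // eq_ij.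
Qed.

(** Sheet [i] over [v] is the vertex g^i (s v). The orbits of [g] are the fibres, and g^i carries
    the chosen lift of an edge to its lift on sheet [i]. *)
Lemma cyclic_sheets : sheeted q (fun e => @rotate N (a e)).
Proof.
have [lift liftP] := fin_all_exists a_lift.
pose fV (x : vertex X * 'I_N.+1) := iter x.2 g.1 (s x.1).
pose fE (x : dedge X * 'I_N.+1) := (g ^+ x.2)%g.2 (lift x.1).
have fVq x : hV q (fV x) = x.1 by rewrite q_iter qs.
have fEq x : hE q (fE x) = x.1.
  by have [_ _ _ _ ->] := cover_autP (groupX x.2 qg); have [] := liftP x.1.
have fVi : injective fV.
  move=> [v i] [w j] eq_f; have := congr1 (hV q) eq_f; rewrite !fVq /= => vw.
  by rewrite -vw in eq_f *; congr (_, _); apply: iter_inj eq_f.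
have fEo e i : org (fE (e, i)) = fV (org e, i).
  have [-> _ _ _ _] := cover_autP (groupX i qg).
  by have [_ -> _] := liftP e; rewrite gE.
have fEt e i : trm (fE (e, i)) = fV (trm e, rotate (a e) i).
  have [_ -> _ _ _] := cover_autP (groupX i qg).
  have [_ _ ->] := liftP e; rewrite !gE -iterD /fV /= iter_mod; congr (iter _ _ _).
have fEi : injective fE.
  move=> [e i] [e' j] eq_f; have := congr1 (hE q) eq_f; rewrite !fEq /= => ee'.
  by have := congr1 org eq_f; rewrite !fEo ee' => /fVi[->].
have fVs w : exists x, fV x = w.
  have [|i ->] := g_tr (w := s (hV q w)) (w' := w); first by rewrite qs.
  by exists (hV q w, inord (i %% N.+1)); rewrite /fV /= inordK ?ltn_mod // iter_mod gE.
have fEs e : exists x, fE x = e.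
  have [[v i] vi] := fVs (org e); exists (hE q e, i).
  have vq : v = org (hE q e) by rewrite hom_org -vi fVq.
  apply: (covq.2 (org e)).1; rewrite ?inE ?fEq // fEo -vi vq //.
have [[hV' fV'] [hE' fE']] := (fin_all_exists fVs, fin_all_exists fEs).
exists fV, fE; split=> //.
- by exists hV' => //; apply: inj_can_sym.
- by exists hE' => //; apply: inj_can_sym.
Qed.
End CyclicSheets.

(** The fibre is unchanged and voltages are read through [p], so the towers over X and Y share the
    same [a]. *)
Lemma pullback_sheets (Y Z X : sgraph) (p : ghom Y X) (q : ghom Z X)
    (I : finType) (act : dedge X -> I -> I) :
  sheeted q act -> sheeted (pb_fst p q) (fun e => act (hE p e)).
Proof.
case=> fV [fE [[gV fVK gVK] [gE fEK gEK] fVq fEq fP]].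
have fVp (x : vertex Y * I) : hV p x.1 == hV q (fV (hV p x.1, x.2)).
  by rewrite fVq.
have fEp (x : dedge Y * I) : hE p x.1 == hE q (fE (hE p x.1, x.2)).
  by rewrite fEq.
pose FV x : vertex (pullback p q) := exist _ (x.1, fV (hV p x.1, x.2)) (fVp x).
pose FE x : dedge (pullback p q) := exist _ (x.1, fE (hE p x.1, x.2)) (fEp x).
exists FV, FE; split=> //.
- exists (fun w => ((val w).1, (gV (val w).2).2)) => [[y i] | [[y z] /= yz]].
    by rewrite /= fVK.
  apply: val_inj; congr (_, _) => /=; rewrite (eqP yz) -{1}[z]gVK fVq.
  by rewrite -surjective_pairing gVK.
- exists (fun w => ((val w).1, (gE (val w).2).2)) => [[y i] | [[y z] /= yz]].
    by rewrite /= fEK.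
  apply: val_inj; congr (_, _) => /=; rewrite (eqP yz) -{1}[z]gEK fEq.
  by rewrite -surjective_pairing gEK.
move=> e i; split; apply: val_inj; congr (_, _).
  by rewrite /= -hom_org (fP _ _).1.
by rewrite /= -hom_trm (fP _ _).2.
Qed.

(** Sheet [h] over [v] is the translate of [s v] by the inverse of [h]; the inverse makes the
    passage along an edge a right translation of labels. *)
Lemma galois_sheets (Y X : sgraph) (p : ghom Y X) : is_galois p ->
  exists b : dedge X -> subg_of (cover_aut_group p),
    sheeted p (fun e => translation (b e)).
Proof.
move=> [covp conY trp]; have [s ps] := cover_section covp.
have /fin_all_exists[lift liftP] : forall e, exists x : dedge Y * subg_of (cover_aut_group p),
    [/\ hE p x.1 = e, org x.1 = s (org e) & trm x.1 = (val x.2).1 (s (trm e))].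
  move=> e; have [e' [e'o e'e]] := cover_lift_edge covp (ps (org e)).
  have [||t pt te'] := trp (trm e) (s (trm e)) (trm e'); first by rewrite inE ps.
    by rewrite inE -hom_trm e'e.
  by exists (e', subg _ t); rewrite /= subgK.
pose H := subg_of (cover_aut_group p).
pose fV (x : vertex X * H) := (val x.2^-1%g).1 (s x.1).
pose fE (x : dedge X * H) := (val x.2^-1%g).2 (lift x.1).1.
have autP (h : H) := cover_autP (subgP h).
have fVp x : hV p (fV x) = x.1 by have [_ _ _ -> _] := autP x.2^-1%g.
have fEp x : hE p (fE x) = x.1.
  by have [_ _ _ _ ->] := autP x.2^-1%g; have [] := liftP x.1.
have fVi : injective fV.
  move=> [v h] [w k] eq_f; have := congr1 (hV p) eq_f; rewrite !fVp /= => vw.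
  rewrite -vw in eq_f *; congr (_, _); apply: invg_inj; apply: val_inj.
  exact: cover_aut_free covp conY (subgP _) (subgP _) eq_f.
have fEo e h : org (fE (e, h)) = fV (org e, h).
  by have [-> _ _ _ _] := autP h^-1%g; have [_ -> _] := liftP e.
have fEi : injective fE.
  move=> [e i] [e' j] eq_f; have := congr1 (hE p) eq_f; rewrite !fEp /= => ee'.
  by have := congr1 org eq_f; rewrite !fEo ee' => /fVi[->].
have fVs w : exists x, fV x = w.
  have [||t pt <-] := trp (hV p w) (s (hV p w)) w; rewrite ?inE ?ps //.
  by exists (hV p w, (subg _ t)^-1%g); rewrite /fV invgK /= subgK.
have fEs e : exists x, fE x = e.
  have [[v h] vh] := fVs (org e); exists (hE p e, h).
  have vp : v = org (hE p e) by rewrite hom_org -vh fVp.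
  by apply: (covp.2 (org e)).1; rewrite ?inE ?fEp // fEo -vh vp.
have [[hV' fV'] [hE' fE']] := (fin_all_exists fVs, fin_all_exists fEs).
exists (fun e => (lift e).2^-1%g), fV, fE; split=> //.
- by exists hV' => //; apply: inj_can_sym.
- by exists hE' => //; apply: inj_can_sym.
move=> e h; split=> //; have [_ -> _ _ _] := autP h^-1%g.
have [_ _ ->] := liftP e; rewrite /fV /= /translation invMg invgK.
by rewrite /= permM.
Qed.

(** Transitivity gives a [g0] with the right effect on one vertex; unique lifting extends the
    agreement to all of [Z1]. *)
Lemma cover_aut_descends (Z1 Z0 X : sgraph) (q : ghom Z0 X) (r : ghom Z1 Z0) g :
    is_galois q -> connected Z1 -> g \in cover_aut (ghom_comp q r) ->
  exists2 g0, g0 \in cover_aut q & forall w, hV r (g.1 w) = g0.1 (hV r w).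
Proof.
move=> [covq conZ0 trq] conZ1 g_aut.
have [_ _ _ gV gE] := cover_autP g_aut.
have [G [GV GE]] := cover_aut_ghom g_aut.
have /andP[/card_gt0P[w0 _] _] := conZ1.
have [||g0 g0q g0w] := trq (hV q (hV r w0)) (hV r w0) (hV r (g.1 w0)).
- by rewrite inE.
- by have := gV w0; rewrite /= inE => ->.
have [_ _ _ _ g0E] := cover_autP g0q.
have [G0 [G0V G0E]] := cover_aut_ghom g0q.
exists g0 => // w; have [||eV _] := @cover_lift_unique _ _ _ q
    (ghom_comp r G) (ghom_comp G0 r) w0 covq conZ1.
- by move=> e; have := gE e; rewrite /= GE G0E g0E.
- by rewrite /= GV G0V.
by have := eV w; rewrite /= GV G0V.
Qed.

(** Generator, section and voltages are chosen at level n + 1; their images at level n satisfy the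
    same relations, hence a common [a]. *)
Lemma tower_sheets (l : nat) (T : tower) (n : nat) :
    prime l -> is_Zl_tower l T -> 0 < n ->
  exists a : dedge (T 0) -> nat,
    sheeted (tcomp T n) (fun e => @rotate (l ^ n).-1 (a e)) /\
    sheeted (tcomp T n.+1) (fun e => @rotate (l ^ n.+1).-1 (a e)).
Proof.
move=> pr_l [conT covT galT] n_gt0; have l_gt0 := prime_gt0 pr_l.
have card_gal k : 0 < k -> #|cover_aut (tcomp T k)| = (l ^ k).-1.+1.
  move=> /galT[_ /card_isog ->]; rewrite card_Zp ?expn_gt0 ?l_gt0 //.
  by rewrite prednK // expn_gt0 l_gt0.
have [gal0 _] := galT n n_gt0; have [gal1 iso1] := galT n.+1 isT.
have [cov0 _ _] := gal0; have [cov1 con1 tr1] : is_galois (tcomp T n.+1) := gal1.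
have /cyclicP[g def_g] : cyclic (cover_aut (tcomp T n.+1)).
  rewrite (isog_cyclic iso1) /= /Zp; case: (1 < _); last exact: cyclic1.
  by rewrite Zp_cycle cycle_cyclic.
have g_aut : g \in cover_aut (tcomp T n.+1) by rewrite def_g cycle_id.
have g_tr w w' : hV (tcomp T n.+1) w = hV (tcomp T n.+1) w' ->
    exists i, w' = (g ^+ i)%g.1 w.
  move=> ww'; have [||t + <-] := tr1 (hV (tcomp T n.+1) w) w w'.
  - by rewrite inE.
  - by rewrite inE ww'.
  by rewrite def_g => /cycleP[i ->]; exists i.
have [g0 g0_aut gg0] := cover_aut_descends gal0 con1 g_aut.
have gg0X i w : hV (tstep T n) ((g ^+ i)%g.1 w) = (g0 ^+ i)%g.1 (hV (tstep T n) w).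
  rewrite !(expg_pair _ _).1 !permX; elim: i => //= i <-; exact: gg0.
have [s qs] := cover_section cov1.
have /fin_all_exists[a aP] : forall e, exists k, exists e', [/\ hE (tcomp T n.+1) e' = e,
    org e' = s (org e) & trm e' = (g ^+ k)%g.1 (s (trm e))].
  move=> e; have [e' [e'o e'e]] := cover_lift_edge cov1 (qs (org e)).
  have [|k te'] := g_tr (s (trm e)) (trm e').
    by rewrite qs -hom_trm e'e.
  by exists k, e'.
exists a; split; last first.
  apply: (cyclic_sheets cov1 g_aut g_tr _ qs aP) => v.
  by rewrite card_galois_fiber // card_gal.
apply: (cyclic_sheets (s := fun v => hV (tstep T n) (s v)) cov0 g0_aut) => //.
- move=> w w'; have [x <-] := (covT n).1 w; have [x' <-] := (covT n).1 w'.
  by move=> /(g_tr x x')[i ->]; exists i; rewrite gg0X.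
- by move=> v; rewrite card_galois_fiber // card_gal.
move=> e; have [e' [e'e e'o e't]] := aP e; exists (hE (tstep T n) e').
by rewrite hom_org hom_trm e'o e't gg0X.
Qed.

(** For large n the alternatives separate mu > 0 from mu = 0. The case [fbar] = 0 falls under the
    first, so [mup] is read only on nonzero polynomials. *)
Lemma spanning_trees_dichotomy (l n : nat) (X Z0 Z1 : sgraph) (q0 : ghom Z0 X)
    (q1 : ghom Z1 X) (a : dedge X -> nat)
    (fbar := map_poly intr (voltage_det a) : {poly 'F_l})
    (k0 := #|spanning_trees Z0|) (k1 := #|spanning_trees Z1|) :
    prime l -> connected X -> connected Z0 -> connected Z1 ->
    sheeted q0 (fun e => @rotate (l ^ n).-1 (a e)) ->
    sheeted q1 (fun e => @rotate (l ^ n.+1).-1 (a e)) ->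
  (('X - 1%:P) ^+ prim_count l n %| fbar)%R
    /\ logn l k0 + prim_count l n <= logn l k1 + 1 \/
  [/\ fbar != 0%R, mup 1%R fbar < prim_count l n &
           logn l k1 + 1 = logn l k0 + mup 1%R fbar].
Proof.
move=> pr_l conX con0 con1 Zq0 Zq1.
have X_gt0 : 0 < #|vertex X| by case/andP: conX.
have l_gt0 := prime_gt0 pr_l.
have [z prim_z] := C_prim_root_exists (ltn0Sn (l ^ n.+1).-1).
have defN : (l ^ n.+1).-1.+1 = l * (l ^ n).-1.+1.
  by rewrite !prednK ?expn_gt0 ?l_gt0 // expnS.
have k01 := card_spanning_trees_step defN prim_z X_gt0 Zq0 Zq1.
have k0_gt0 := spanning_trees_gt0 con0; have k1_gt0 := spanning_trees_gt0 con1.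
have [f_dvd | f_ndvd] := boolP (('X - 1%:P) ^+ prim_count l n %| fbar)%R; [left | right].
  split=> //; exact: (logn_step_ge pr_l prim_z k0_gt0 k1_gt0 k01).
have f0 : fbar != 0%R by apply: contraNneq f_ndvd => ->; apply: dvdp0.
have lt_f : mup 1%R fbar < prim_count l n by rewrite mup_ltn.
by split=> //; apply: (logn_step_eq pr_l prim_z k0_gt0 k1_gt0 k01).
Qed.

(** Taking differences removes nu and turns mu l^n into mu times [prim_count]. *)
Lemma iwasawa_step (l : nat) (T : tower) (mu lambda : nat) :
    prime l -> iwasawa_invariants l T mu lambda ->
  exists n0, forall n, n0 <= n ->
    logn l #|spanning_trees (T n.+1)|
      = logn l #|spanning_trees (T n)| + mu * prim_count l n + lambda.
Proof.
move=> pr_l [nu [n0 kT]]; exists n0 => n le_n.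
have := kT n.+1 (leqW le_n); have := kT n le_n.
have := prim_countE n pr_l; move: (prim_count l n) => c <-.
rewrite mulnDr mulnS; lia.
Qed.

Lemma mup_exp (F : fieldType) (x : F) (f : {poly F}) k :
  f != 0%R -> mup x (f ^+ k)%R = k * mup x f.
Proof.
move=> f0; elim: k => [|k IHk]; first by rewrite expr0 mupNroot // root1.
by rewrite exprS mupM ?expf_neq0 // IHk.
Qed.

Theorem theoremA (l : nat) (X : tower) (Y : sgraph) (p : ghom Y (X 0))
    (muX lambdaX muY lambdaY : nat) :
  prime l ->
  connected (X 0) ->
  euler_char (X 0) <> 0%R ->
  is_Zl_tower l X ->
  is_galois p ->
  (l.-group (cover_aut p))%g ->
  (forall n, connected (pb_tower p n)) ->
  iwasawa_invariants l X muX lambdaX ->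
  iwasawa_invariants l (pb_tower p) muY lambdaY ->
  (muX = 0 <-> muY = 0) /\
  (muX = 0 -> lambdaY + 1 = degree p * (lambdaX + 1)).
Proof.
move=> pr_l conX _ towX galp pG conPB.
move=> /(iwasawa_step pr_l)[n1 kX] /(iwasawa_step pr_l)[n2 kY].
have [covp conY _] := galp.
have deg : degree p = #|cover_aut p|.
  have /andP[/card_gt0P[v _] _] := conX.
  by rewrite -(card_fiber v covp conY) card_galois_fiber.
have deg_gt0 : 0 < degree p by rewrite deg cardG_gt0.
(* [n] is positive and lies beyond the onset of both growth formulas. As [c] >= l^n > n, [c] also
   exceeds [Y:X] (lambdaX + 1) and lambdaY + 1. *)
pose n := (n1 + n2 + (lambdaX + 1) * degree p + lambdaY + 4).+1.
pose c := prim_count l n.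
have c_gt : (lambdaX + 1) * degree p + lambdaY + 1 < c.
  have := prim_countE n pr_l; have := ltn_expl n (prime_gt1 pr_l).
  rewrite expnS -/c; have := prime_gt1 pr_l; rewrite {1}/n; nia.
have lamX_lt : lambdaX + 1 < c.
  by have := leq_pmulr (lambdaX + 1) deg_gt0; lia.
have mu_gt0 mu : 0 < mu -> c <= mu * c by apply: leq_pmull.
have [a [X0 X1]] := tower_sheets pr_l towX (isT : 0 < n).
have [b Yb] := galois_sheets galp.
have [conT _ _] := towX.
have pH : (l.-group [set: subg_of (cover_aut_group p)])%g.
  by rewrite /pgroup cardsT card_sub.
have := spanning_trees_dichotomy pr_l conX (conT n) (conT n.+1) X0 X1.
have := spanning_trees_dichotomy pr_l conY (conPB n) (conPB n.+1)
  (pullback_sheets p X0) (pullback_sheets p X1).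
rewrite (voltage_det_pcover (pchar_Fp pr_l) pH a Yb) card_sub -deg -/c.
have -> := kX n _; last by rewrite /n; lia.
have /= -> := kY n _; last by rewrite /n; lia.
rewrite -/c; set f := map_poly _ _.
rewrite -!addnA !leq_add2l => Ycase Xcase.
case: Ycase Xcase => [[dvdY leY]|[Y0 ltY /addnI eqY]] [[dvdX leX]|[f0 ltX /addnI eqX]].
(* With mu = 0 the growth would be lambda + 1 < [c]; so both mu are positive. *)
- have muX0 : muX != 0 by apply: contraTneq leX => ->; rewrite -ltnNge.
  have muY0 : muY != 0 by apply: contraTneq leY => ->; rewrite -ltnNge; lia.
  by split=> [|/eqP]; [split=> /eqP|]; rewrite ?(negPf muX0) ?(negPf muY0).
(* Impossible: [f] has order lambdaX + 1, so its power has order [Y:X] (lambdaX + 1), which is below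
   [c]. *)
- have muX0 : muX = 0.
    by apply/eqP; rewrite -leqn0 leqNgt; apply/negP=> /mu_gt0; lia.
  have := dvdY; rewrite -mup_geq ?expf_neq0 // mup_exp // -eqX muX0; lia.
(* Impossible: the order of a positive power is at least that of [f], hence at least [c]. *)
- have f0 : f != 0%R by apply: contraNneq Y0 => ->; rewrite expf_eq0 deg_gt0 eqxx.
  move: dvdX; rewrite -mup_geq // => le_c; have := ltY; rewrite mup_exp //.
  by rewrite ltnNge (leq_trans le_c) // leq_pmull.
- have muX0 : muX = 0.
    by apply/eqP; rewrite -leqn0 leqNgt; apply/negP=> /mu_gt0; lia.
  have muY0 : muY = 0.
    by apply/eqP; rewrite -leqn0 leqNgt; apply/negP=> /mu_gt0; lia.
  split=> // _; move: eqY; rewrite mup_exp // -eqX muX0 muY0; lia.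
Qed.
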